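(* A graph $G$ is $\{P_5,\overline{P_5}\}$-free if and only if at least one of the following holds: (i) $G$ is a split graph; (ii) $G$ is a pentagon; (iii) $G$ is obtained by substitution from smaller $\{P_5,\overline{P_5}\}$-free graphs; (iv) $G$ or $\overline{G}$ is obtained by split graph unification from smaller $\{P_5,\overline{P_5}\}$-free graphs.
   Context: All graphs are finite and simple; graphs are considered up to isomorphism. $V_G$ is the vertex-set of $G$, $\overline{G}$ is the complement of $G$, and $G[X]$ is the subgraph of $G$ induced by $X\subseteq V_G$; $G\smallsetminus v=G[V_G\smallsetminus\{v\}]$. $P_5$ is the path on five vertices, and a pentagon is the cycle $C_5$ on five vertices. $G$ is $\mathcal{H}$-free if no induced subgraph of $G$ is isomorphic to a member of $\mathcal{H}$. A split graph is a graph whose vertex-set can be partitioned into a (possibly empty) clique and a (possibly empty) stable set. A graph $H$ is smaller than $G$ if $|V_H|<|V_G|$. A vertex $v\notin X$ is complete (anti-complete) to $X$ if it is adjacent (non-adjacent) to every vertex of $X$; disjoint sets $A,B$ are complete (anti-complete) to each other if every vertex of $A$ is complete (anti-complete) to $B$. Substitution: given graphs $G_1,G_2$ with disjoint vertex-sets and $u\in V_{G_2}$, $G$ is obtained by substituting $G_1$ for $u$ in $G_2$ if $V_G=V_{G_1}\cup(V_{G_2}\smallsetminus\{u\})$, $G[V_{G_1}]=G_1$, $G[V_{G_2}\smallsetminus\{u\}]=G_2\smallsetminus u$, and each $v\in V_{G_2}\smallsetminus\{u\}$ is complete to $V_{G_1}$ in $G$ if $v$ is adjacent to $u$ in $G_2$,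 and anti-complete to $V_{G_1}$ in $G$ otherwise. $G$ is obtained by substitution from graphs with a given property if $G_1$ and $G_2$ can be chosen to have that property (here ''smaller'' means smaller than $G$). Split graph unification: let $A,B,C,L,T$ be pairwise disjoint sets with $A$ and $C$ non-empty, and let $a,c$ be distinct vertices not in $A\cup B\cup C\cup L\cup T$. Let $G_1$ be a graph with vertex-set $A\cup L\cup T\cup\{c\}$ in which $L$ is a (possibly empty) clique, $T$ is a (possibly empty) stable set, $A$ is anti-complete to $T$, and $c$ is complete to $L$ and anti-complete to $A\cup T$. Let $G_2$ be a graph with vertex-set $B\cup C\cup L\cup T\cup\{a\}$ in which $G_2[L\cup T]=G_1[L\cup T]$, $T$ is anti-complete to $C$, $L$ is complete to $B\cup C$, and $a$ is complete to $B$ and anti-complete to $C\cup L\cup T$. Then $(G_1,G_2)$ is called a composable pair, and its split graph unification is the graph $G$ with vertex-set $A\cup B\cup C\cup L\cup T$ such that $G[A\cup L\cup T]=G_1\smallsetminus c$, $G[B\cup C\cup L\cup T]=G_2\smallsetminus a$, and $A$ is complete to $B$ and anti-complete to $C$ in $G$. A graph is obtained by split graph unification from graphs with a given property if it is the split graph unification of a composable pair $(G_1,G_2)$ in which both $G_1$ and $G_2$ have that property. *)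

(* Defs.v *)
From mathcomp Require Import all_boot.

Set Implicit Arguments.
Unset Strict Implicit.
Unset Printing Implicit Defensive.

Record sgraph (V : finType) := SGraph {
  adj :> rel V;
  adj_sym : symmetric adj;
  adj_irr : irreflexive adj
}.

Definition iso (V W : finType) (G : sgraph V) (H : sgraph W) : Prop :=
  exists f : V -> W, bijective f /\ forall x y, G x y = H (f x) (f y).

Section Complement.
Variables (V : finType) (G : sgraph V).

Definition compl_rel : rel V := fun x y => (x != y) && ~~ G x y.

Lemma compl_sym : symmetric compl_rel.
Proof. by move=> x y; rewrite /compl_rel eq_sym adj_sym. Qed.

Lemma compl_irr : irreflexive compl_rel.
Proof. by move=> x; rewrite /compl_rel eqxx. Qed.

Definition compl : sgraph V := SGraph compl_sym compl_irr.

End Complement.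

Section Induced.
Variables (V : finType) (G : sgraph V) (X : {set V}).

Definition induced_rel : rel {x : V | x \in X} := fun x y => G (val x) (val y).

Lemma induced_sym : symmetric induced_rel.
Proof. by move=> x y; apply: adj_sym. Qed.

Lemma induced_irr : irreflexive induced_rel.
Proof. by move=> x; apply: adj_irr. Qed.

Definition induced : sgraph {x : V | x \in X} := SGraph induced_sym induced_irr.

End Induced.

Section Path.
Variable n : nat.

Definition path_rel : rel 'I_n := fun i j => (i.+1 == j) || (j.+1 == i).

Lemma path_rel_sym : symmetric path_rel.
Proof. by move=> i j; rewrite /path_rel orbC. Qed.

Lemma path_rel_irr : irreflexive path_rel.
Proof. by move=> i; rewrite /path_rel orbb -[X in _ == X]addn0 -addn1 eqn_add2l. Qed.

Definition path_graph : sgraph 'I_n := SGraph path_rel_sym path_rel_irr.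

End Path.

Section Cycle.
Variable n : nat.

(* The conjunct i != j only matters for n = 1. *)
Definition cycle_rel : rel 'I_n :=
  fun i j => (i != j) && ((i.+1 %% n == j) || (j.+1 %% n == i)).

Lemma cycle_rel_sym : symmetric cycle_rel.
Proof. by move=> i j; rewrite /cycle_rel eq_sym orbC. Qed.

Lemma cycle_rel_irr : irreflexive cycle_rel.
Proof. by move=> i; rewrite /cycle_rel eqxx. Qed.

Definition cycle_graph : sgraph 'I_n := SGraph cycle_rel_sym cycle_rel_irr.

End Cycle.

Definition free (W : finType) (H : sgraph W) (V : finType) (G : sgraph V) : Prop :=
  forall X : {set V}, ~ iso (induced G X) H.

Definition P5_coP5_free (V : finType) (G : sgraph V) : Prop :=
  free (path_graph 5) G /\ free (compl (path_graph 5)) G.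

Definition is_clique (V : finType) (G : sgraph V) (K : {set V}) : Prop :=
  {in K &, forall x y, x != y -> G x y}.

Definition is_stable (V : finType) (G : sgraph V) (S : {set V}) : Prop :=
  {in S &, forall x y, ~~ G x y}.

Definition is_split (V : finType) (G : sgraph V) : Prop :=
  exists K S : {set V},
    [/\ K :|: S = [set: V], K :&: S = set0, is_clique G K & is_stable G S].

Definition is_pentagon (V : finType) (G : sgraph V) : Prop :=
  iso G (cycle_graph 5).

(* Two families of vertices of G, given by maps f and g (in all uses injective,
   with disjoint images), are complete or anti-complete to each other. *)
Definition complete_to (V : finType) (G : sgraph V)
    (I J : Type) (f : I -> V) (g : J -> V) : Prop :=
  forall i j, G (f i) (g j).

Definition anticomplete_to (V : finType) (G : sgraph V)
    (I J : Type) (f : I -> V) (g : J -> V) : Prop :=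
  forall i j, ~~ G (f i) (g j).

(* Disjoint unions of vertex-sets are rendered as sum types: here the
   vertex-set of G is the disjoint union of that of G1 and of V2 minus u. *)
Definition is_substitution (V1 V2 : finType) (G1 : sgraph V1) (G2 : sgraph V2)
    (u : V2) (G : sgraph (V1 + {v : V2 | v != u})%type) : Prop :=
  [/\ forall x y : V1, G (inl x) (inl y) = G1 x y,
      forall v w : {v : V2 | v != u}, G (inr v) (inr w) = G2 (val v) (val w)
    & forall v : {v : V2 | v != u},
        (G2 (val v) u -> forall x : V1, G (inr v) (inl x)) /\
        (~~ G2 (val v) u -> forall x : V1, ~~ G (inr v) (inl x))].

Definition from_substitution (Q : forall W : finType, sgraph W -> Prop)
    (V : finType) (G : sgraph V) : Prop :=
  exists (V1 V2 : finType) (G1 : sgraph V1) (G2 : sgraph V2) (u : V2)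
         (G' : sgraph (V1 + {v : V2 | v != u})%type),
    [/\ is_substitution G1 G2 G', iso G G', Q V1 G1 & Q V2 G2].

Section SplitUnification.
Variables A B C L T : finType.

(* The vertex-sets A + L + T + {c} of G1, B + C + L + T + {a} of G2 and
   A + B + C + L + T of their unification; None plays the role of c in G1
   and of a in G2. *)
Definition vert1 : finType := option (A + (L + T))%type.
Definition vert2 : finType := option ((B + C) + (L + T))%type.
Definition vertU : finType := (A + ((B + C) + (L + T)))%type.

Definition A1 (x : A) : vert1 := Some (inl x).
Definition L1 (x : L) : vert1 := Some (inr (inl x)).
Definition T1 (x : T) : vert1 := Some (inr (inr x)).
Definition c1 (_ : unit) : vert1 := None.

Definition B2 (x : B) : vert2 := Some (inl (inl x)).
Definition C2 (x : C) : vert2 := Some (inl (inr x)).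
Definition L2 (x : L) : vert2 := Some (inr (inl x)).
Definition T2 (x : T) : vert2 := Some (inr (inr x)).
Definition a2 (_ : unit) : vert2 := None.

Definition AU (x : A) : vertU := inl x.
Definition BU (x : B) : vertU := inr (inl (inl x)).
Definition CU (x : C) : vertU := inr (inl (inr x)).

Definition ALT_U (x : A + (L + T)) : vertU :=
  match x with inl a => inl a | inr s => inr (inr s) end.
Definition BCLT_U (x : (B + C) + (L + T)) : vertU := inr x.

Definition composable_left (G1 : sgraph vert1) : Prop :=
  [/\ forall x y : L, x != y -> G1 (L1 x) (L1 y),
      forall x y : T, ~~ G1 (T1 x) (T1 y),
      anticomplete_to G1 A1 T1,
      complete_to G1 c1 L1
    & anticomplete_to G1 c1 A1 /\ anticomplete_to G1 c1 T1].

Definition composable_right (G2 : sgraph vert2) : Prop :=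
  [/\ anticomplete_to G2 T2 C2,
      complete_to G2 L2 B2 /\ complete_to G2 L2 C2,
      complete_to G2 a2 B2
    & [/\ anticomplete_to G2 a2 C2, anticomplete_to G2 a2 L2
        & anticomplete_to G2 a2 T2]].

Definition composable (G1 : sgraph vert1) (G2 : sgraph vert2) : Prop :=
  [/\ 0 < #|A|, 0 < #|C|, composable_left G1, composable_right G2
    & forall x y : (L + T)%type,
        G2 (Some (inr x)) (Some (inr y)) = G1 (Some (inr x)) (Some (inr y))].

Definition is_split_unification (G1 : sgraph vert1) (G2 : sgraph vert2)
    (G : sgraph vertU) : Prop :=
  [/\ forall x y, G (ALT_U x) (ALT_U y) = G1 (Some x) (Some y),
      forall x y, G (BCLT_U x) (BCLT_U y) = G2 (Some x) (Some y),
      complete_to G AU BU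
    & anticomplete_to G AU CU].

End SplitUnification.

Definition from_split_unification (Q : forall W : finType, sgraph W -> Prop)
    (V : finType) (G : sgraph V) : Prop :=
  exists (A B C L T : finType)
         (G1 : sgraph (vert1 A L T)) (G2 : sgraph (vert2 B C L T))
         (G' : sgraph (vertU A B C L T)),
    [/\ composable G1 G2, is_split_unification G1 G2 G', iso G G',
        Q _ G1 & Q _ G2].

Definition smaller_free (V : finType) (W : finType) (H : sgraph W) : Prop :=
  #|W| < #|V| /\ P5_coP5_free H.

(* Main.v *)
From HB Require Import structures.
Require Import Defs.
From mathcomp Require Import all_boot zify.

(* Both directions of the substitution and unification cases rest on the fact
   that P5 and its complement are small: how their five vertices can be spread
   over the parts of a decomposition is settled by enumeration.

   Conversely, let G be {P5, co-P5}-free.  If G has an induced pentagon Q, every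
   vertex is complete to Q, anticomplete to Q, or a twin of a vertex of Q; so
   either G = Q, or Q or one of its twin classes is a proper homogeneous set.
   If G is C5-free and not split, then by Foldes and Hammer G or its complement
   contains 2K2.  Among the pairs (A, C) of anticomplete sets, in G or in its
   complement, with A connected and non-trivial and C without isolated
   vertices, take one maximizing |A| + |C|, say in G.  A vertex outside A that is
   mixed on A is then complete to C and to the vertices complete to A.  If the
   set L of mixed vertices is a clique, A yields a split graph unification of
   G.  Otherwise let M be an anticomponent of L with at least two vertices,
   chosen so that as many vertices anticomplete to A and C as possible are
   complete to it; then M yields a split graph unification of the complement. *)

Set Implicit Arguments.
Unset Strict Implicit.
Unset Printing Implicit Defensive.

(** * Isomorphisms and induced copies of five-vertex graphs *)

Lemma iso_from (V W : finType) (G : sgraph V) (H : sgraph W) (g : W -> V) :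
  injective g -> (forall x, exists w, g w = x) ->
  (forall x y, G (g x) (g y) = H x y) -> iso G H.
Proof.
move=> g_inj g_surj gE.
have g_surjb x : exists w, g w == x by have [w <-] := g_surj x; exists w.
have fK x : g (xchoose (g_surjb x)) = x by apply/eqP/(xchooseP (g_surjb x)).
exists (fun x => xchoose (g_surjb x)); split; last by move=> x y; rewrite -gE !fK.
by exists g => [//|w]; apply: g_inj.
Qed.

Lemma iso_inv (V W : finType) (G : sgraph V) (H : sgraph W) :
  iso G H -> exists g : W -> V,
    [/\ injective g, (forall x, exists w, g w = x) & forall x y, G (g x) (g y) = H x y].
Proof.
move=> [f [[g fK gK] fE]]; exists g; split=> [|x|x y]; first exact: can_inj gK.
  by exists (f x).
by rewrite fE !gK.
Qed.

Definition path5 : rel nat := fun i j => (i.+1 == j) || (j.+1 == i).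
Definition copath5 : rel nat := fun i j => (i != j) && ~~ path5 i j.

Definition all5 (P : pred nat) := all P (iota 0 5).

Lemma all5P (P : pred nat) : reflect (forall i, i < 5 -> P i) (all5 P).
Proof.
apply: (iffP allP) => [PP i i5 | PP i]; last by rewrite mem_iota => /PP.
by apply: PP; rewrite mem_iota.
Qed.

(** A boolean check over all colourings of five indices by [cs], meant to be evaluated by
    [vm_compute]. The default [d] is only read at indices from 5 on. *)
Definition exhaust (T : eqType) (d : T) (cs : seq T) (P : (nat -> T) -> bool) :=
  all (fun c0 => all (fun c1 => all (fun c2 => all (fun c3 => all (fun c4 =>
    P (nth d [:: c0; c1; c2; c3; c4])) cs) cs) cs) cs) cs.

(** When [P] inspects only the indices 0 to 4, as predicates built from [all5] do, the conclusion is
    convertible to [P k]. *)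
Lemma exhaustP (T : eqType) (d : T) cs P (k : nat -> T) : exhaust d cs P ->
  (forall i, i < 5 -> k i \in cs) -> P (nth d [:: k 0; k 1; k 2; k 3; k 4]).
Proof.
move=> /allP/(_ (k 0)) ex kcs; move: ex => /(_ (kcs 0 isT))/allP/(_ _ (kcs 1 isT)).
move=> /allP/(_ _ (kcs 2 isT))/allP/(_ _ (kcs 3 isT)).
by move=> /allP/(_ _ (kcs 4 isT)).
Qed.

(* Only the values of v below 5 matter. *)
Definition induces (h : rel nat) (V : Type) (e : rel V) :=
  exists v : nat -> V, forall i j, i < 5 -> j < 5 -> e (v i) (v j) = h i j.

(** Distinct vertices have distinct neighbourhoods; this makes every map [v] as in [induces]
    injective on the indices below 5. *)
Definition twinfree (h : rel nat) :=
  all5 (fun i => all5 (fun j => all5 (fun l => h i l == h j l) ==> (i == j))).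

Lemma twinfreeP h i j : twinfree h -> i < 5 -> j < 5 ->
  (forall l, l < 5 -> h i l = h j l) -> i = j.
Proof.
move=> /all5P tw i5 j5 hij; have /all5P/(_ j j5)/implyP imp := tw i i5.
by apply/eqP/imp/all5P => l l5; apply/eqP/hij.
Qed.

Lemma freeP (h : rel nat) (H : sgraph 'I_5) (V : finType) (G : sgraph V) :
  twinfree h -> (forall i j : 'I_5, H i j = h i j) ->
  free H G <-> ~ induces h G.
Proof.
move=> tw HE; split=> [frG [v vE] | nind X /iso_inv[g [g_inj _ gE]]].
  pose X := [set v (val i) | i : 'I_5].
  have vX (i : 'I_5) : v i \in X by apply: imset_f.
  apply: (frG X); apply: (@iso_from _ _ _ _ (fun i : 'I_5 => exist _ (v i) (vX i))).
  - move=> i j /(congr1 val) /= vij; apply: val_inj.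
    apply: (twinfreeP tw) => [||l l5]; [exact: ltn_ord | exact: ltn_ord |].
    by rewrite -vE ?ltn_ord // vij vE ?ltn_ord.
  - by move=> [x xX]; have /imsetP[i _ xi] := xX; exists i; apply: val_inj.
  - by move=> i j; rewrite HE -vE ?ltn_ord.
apply: nind; exists (fun n => val (g (inord n))) => i j i5 j5.
by have := gE (inord i) (inord j); rewrite /= HE !inordK.
Qed.

Lemma P5_coP5_freeP (V : finType) (G : sgraph V) :
  P5_coP5_free G <-> ~ induces path5 G /\ ~ induces copath5 G.
Proof.
have p5 : free (path_graph 5) G <-> ~ induces path5 G by apply: freeP.
have c5 : free (compl (path_graph 5)) G <-> ~ induces copath5 G by apply: freeP.
by rewrite /P5_coP5_free; tauto.
Qed.

Lemma induces_map h (V W : Type) (e : rel V) (e' : rel W) (f : V -> W) :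
  (forall x y, e' (f x) (f y) = e x y) -> induces h e -> induces h e'.
Proof. by move=> fE [v vE]; exists (f \o v) => i j i5 j5; rewrite /= fE vE. Qed.

(** * Freeness of the basic graphs *)

Lemma complE (V : finType) (G : sgraph V) x y : compl G x y = (x != y) && ~~ G x y.
Proof. by []. Qed.

Lemma complK (V : finType) (G : sgraph V) x y : compl (compl G) x y = G x y.
Proof. by rewrite !complE; case: eqP => [->|_] /=; rewrite ?adj_irr ?negbK. Qed.

Lemma induces_inj h (V : finType) (G : sgraph V) (v : nat -> V) : twinfree h ->
  (forall i j, i < 5 -> j < 5 -> G (v i) (v j) = h i j) ->
  forall i j, i < 5 -> j < 5 -> (v i == v j) = (i == j).
Proof.
move=> tw vE i j i5 j5; apply/eqP/eqP => [vij|->] //.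
by apply: (twinfreeP tw) => // l l5; rewrite -!vE // vij.
Qed.

Lemma induces_compl h h' (V : finType) (G : sgraph V) : twinfree h ->
  (forall i j, i < 5 -> j < 5 -> h' i j = (i != j) && ~~ h i j) ->
  induces h G -> induces h' (compl G).
Proof.
move=> tw h'E [v vE]; exists v => i j i5 j5.
by rewrite complE (induces_inj tw vE) // vE // h'E.
Qed.

Lemma induces_path5_compl (V : finType) (G : sgraph V) :
  induces path5 G -> induces copath5 (compl G).
Proof. exact: induces_compl. Qed.

Lemma induces_copath5_compl (V : finType) (G : sgraph V) :
  induces copath5 G -> induces path5 (compl G).
Proof. by apply: induces_compl => //; do 5?[case=> //]; do 5?[case=> //]. Qed.

Lemma P5_coP5_free_compl (V : finType) (G : sgraph V) :
  P5_coP5_free G -> P5_coP5_free (compl G).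
Proof.
move=> /P5_coP5_freeP[p cp]; apply/P5_coP5_freeP; split=> [/induces_path5_compl | /induces_copath5_compl].
  by move=> i; apply: cp; apply: (@induces_map _ _ _ _ _ id _ i) => x y; rewrite complK.
by move=> i; apply: p; apply: (@induces_map _ _ _ _ _ id _ i) => x y; rewrite complK.
Qed.

Lemma P5_coP5_free_compl_inv (V : finType) (G : sgraph V) :
  P5_coP5_free (compl G) -> P5_coP5_free G.
Proof.
move=> /P5_coP5_freeP[p cp]; apply/P5_coP5_freeP; split.
  by move=> /induces_path5_compl.
by move=> /induces_copath5_compl.
Qed.

Lemma P5_coP5_free_iso (V W : finType) (G : sgraph V) (H : sgraph W) :
  iso G H -> P5_coP5_free H -> P5_coP5_free G.
Proof.
move=> [f [_ fE]] /P5_coP5_freeP[p c]; apply/P5_coP5_freeP.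
by split=> i; [apply: p | apply: c]; apply: (@induces_map _ _ _ _ _ f _ i) => x y; rewrite -fE.
Qed.

Lemma split_compl (V : finType) (G : sgraph V) : is_split G -> is_split (compl G).
Proof.
move=> [K [S [KS KS0 cK sS]]]; exists S, K; split; [by rewrite setUC | by rewrite setIC | |].
  by move=> x y xS yS xy; rewrite complE xy sS.
by move=> x y xK yK; rewrite complE negb_and !negbK; case: eqVneq => //= xy; rewrite cK.
Qed.

(** Each of the edges 01 and 34 of the path has an end in the clique, but no end of the first is
    adjacent to an end of the second. *)
Lemma split_no_path5 (V : finType) (G : sgraph V) : is_split G -> ~ induces path5 G.
Proof.
move=> [K [S [KS KS0 cK sS]]] [v vE].
have inK i j : i < 5 -> j < 5 -> path5 i j -> (v i \in K) || (v j \in K).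
  move=> i5 j5; rewrite -vE // => vij; apply/contraT; rewrite negb_or => /andP[iK jK].
  have inS x : x \notin K -> x \in S.
    by move=> xK; have := in_setT x; rewrite -KS inE (negPf xK).
  by have := sS _ _ (inS _ iK) (inS _ jK); rewrite vij.
have outK i j : i < 5 -> j < 5 -> copath5 i j -> (v i \in K) -> (v j \in K) -> false.
  move=> i5 j5 /andP[ij /negPf pij] iK jK.
  by rewrite -pij -vE //; apply: cK; rewrite ?(induces_inj (h := path5) _ vE).
have /orP[i0|i1] : (v 0 \in K) || (v 1 \in K) by apply: inK.
  have /orP[j|j] : (v 3 \in K) || (v 4 \in K) by apply: inK.
    by have := outK 0 3 isT isT isT i0 j.
  by have := outK 0 4 isT isT isT i0 j.
have /orP[j|j] : (v 3 \in K) || (v 4 \in K) by apply: inK.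
  by have := outK 1 3 isT isT isT i1 j.
by have := outK 1 4 isT isT isT i1 j.
Qed.

Lemma split_free (V : finType) (G : sgraph V) : is_split G -> P5_coP5_free G.
Proof.
move=> sG; apply/P5_coP5_freeP; split; first exact: split_no_path5.
by move=> /induces_copath5_compl; apply/split_no_path5/split_compl.
Qed.

Lemma pentagon_free : P5_coP5_free (cycle_graph 5).
Proof.
pose c (i j : nat) := (i != j) && ((i.+1 %% 5 == j) || (j.+1 %% 5 == i)).
pose pat (h : rel nat) (k : nat -> nat) :=
  all5 (fun i => all5 (fun j => c (k i) (k j) == h i j)).
(* All maps from five indices to the five vertices of the pentagon are tested. *)
have no h : exhaust 0 (iota 0 5) (fun k => ~~ pat h k) -> ~ induces h (cycle_graph 5).
  move=> /exhaustP ex [v vE]; have := ex (fun i => val (v i)) _.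
  case/(_ _)/negP => [i _|]; first by rewrite mem_iota ltn_ord.
  by apply/all5P => -[|[|[|[|[|]]]]] //= _; apply/all5P => -[|[|[|[|[|]]]]] //= _; rewrite -vE.
by apply/P5_coP5_freeP; split; apply: no; vm_compute.
Qed.

(** * Substitution and split graph unification preserve freeness *)

Definition at_most_one (p : pred nat) :=
  all5 (fun i => all5 (fun j => p i && p j ==> (i == j))).

Lemma at_most_oneP p i j : at_most_one p -> i < 5 -> j < 5 -> p i -> p j -> i = j.
Proof.
move=> /all5P p1 i5 j5 pi pj; have /all5P/(_ j j5) := p1 i i5.
by rewrite pi pj => /eqP.
Qed.

Definition homogeneous5 (h : rel nat) (k : nat -> bool) :=
  all5 (fun i => all5 (fun j => all5 (fun l => [&& k i, k j & ~~ k l] ==> (h i l == h j l)))).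

(** Primality of [h] under substitution: a homogeneous set, given by its indicator [k], is
    everything or has at most one element. *)
Definition prime5 h :=
  exhaust false [:: true; false] (fun k => homogeneous5 h k ==> all5 k || at_most_one k).

(** The indices sent into [G1] form a homogeneous set of [h]. By primality either all of them are
    there, which gives a copy in [G1], or at most one is, and replacing its image by [u] gives a
    copy in [G2]. *)
Lemma substitution_induces h (V1 V2 : finType) (G1 : sgraph V1) (G2 : sgraph V2)
    (u : V2) (G : sgraph (V1 + {v : V2 | v != u})%type) :
  prime5 h -> is_substitution G1 G2 G ->
  induces h G -> induces h G1 \/ induces h G2.
Proof.
move=> /exhaustP prim [GE1 GE2 GE12] [v vE].
pose k i := if v i is inl _ then true else false.
have GE21 (y : {w | w != u}) x : G (inr y) (inl x) = G2 (val y) u.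
  have [com acom] := GE12 y.
  by case E: (G2 (val y) u); [apply: com | apply/negbTE/acom; rewrite E].
have GE21' (y : {w | w != u}) x : G (inl x) (inr y) = G2 u (val y).
  by rewrite adj_sym GE21 adj_sym.
have kin i : i < 5 -> k i \in [:: true; false] by case: (k i).
have hom : homogeneous5 h k.
  apply/all5P => i i5; apply/all5P => j j5; apply/all5P => l l5.
  rewrite -!vE // /k; case: (v i) => // x; case: (v j) => // y; case: (v l) => // z.
  by rewrite !GE21' eqxx.
have /implyP/(_ hom)/orP[/all5P kall|k1] :
  homogeneous5 h k ==> all5 k || at_most_one k := prim k kin.
  left; have := kall 0 isT; rewrite /k; case: (v 0) => // x0 _.
  (* [x0] is a filler for the indices from 5 on. *)
  exists (fun n => if v n is inl x then x else x0) => i j i5 j5; rewrite -vE //.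
  by have := kall i i5; have := kall j j5; rewrite /k; case: (v i) => // x; case: (v j).
right; exists (fun n => if v n is inr x then val x else u) => i j i5 j5; rewrite -vE //.
have : k i -> k j -> i = j by apply: at_most_oneP k1 _ _.
rewrite /k; case Ei: (v i) => [x|x]; case Ej: (v j) => [y|y]; rewrite ?GE2 ?GE21 ?GE21' //.
move=> /(_ isT isT) ij; move: Ej; rewrite -ij Ei => -[<-].
by rewrite !adj_irr.
Qed.

Lemma substitution_free (V1 V2 : finType) (G1 : sgraph V1) (G2 : sgraph V2)
    (u : V2) (G : sgraph (V1 + {v : V2 | v != u})%type) :
  is_substitution G1 G2 G -> P5_coP5_free G1 -> P5_coP5_free G2 -> P5_coP5_free G.
Proof.
move=> sub /P5_coP5_freeP[p1 c1] /P5_coP5_freeP[p2 c2]; apply/P5_coP5_freeP.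
by split=> /(substitution_induces _ sub) [] //; vm_compute.
Qed.

Inductive colour := cA | cB | cC | cL | cT.
Definition code c := match c with cA => 0 | cB => 1 | cC => 2 | cL => 3 | cT => 4 end.
Definition colours := [:: cA; cB; cC; cL; cT].
Lemma codeK : cancel code (nth cA colours). Proof. by case. Qed.
HB.instance Definition _ := Equality.copy colour (can_type codeK).
Lemma mem_colours c : c \in colours. Proof. by case: c. Qed.

(* The adjacencies imposed by a unification between vertices of given parts.
   With aL = None, cA is the part A; with aL = Some false, it is the vertex a
   of G2. *)
Definition forced (aL : option bool) x y : option bool :=
  match x, y with
  | cA, cB | cB, cA => Some true
  | cA, cC | cC, cA | cA, cT | cT, cA => Some false
  | cA, cL | cL, cA => aL
  | cL, cL | cL, cB | cB, cL | cL, cC | cC, cL => Some true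
  | cT, cT | cT, cC | cC, cT => Some false
  | cA, cA => aL
  | _, _ => None
  end.

Definition respects (o : option bool) (b : bool) := if o is Some b' then b == b' else true.

(** The diagonal is exempt because [forced] prescribes adjacency inside the clique [cL], whereas a
    vertex is not adjacent to itself. *)
Definition consistent aL (h : rel nat) k :=
  all5 (fun i => all5 (fun j => (i == j) || respects (forced aL (k i) (k j)) (h i j))).

(* Either c can stand for the vertex in C, or a for the vertex in A. *)
Definition unification_case (h : rel nat) k :=
  all5 (fun i => k i != cB) && at_most_one (fun i => k i == cC)
  || at_most_one (fun i => k i == cA) &&
     all5 (fun i => all5 (fun j => [&& k i == cA, k j == cL & h i j] ==> false)).

Definition unification_ok (h : rel nat) :=
  exhaust cA colours (fun k => consistent None h k ==> unification_case h k).

(** Colour the vertices of a copy of [h] by their parts. By enumeration, either the copy avoids [B]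
    and has at most one vertex in [C], which [c] replaces in [G1], or it has at most one vertex in
    [A], not adjacent to its vertices in [L], which [a] replaces in [G2]. *)
Lemma unification_induces h (A B C L T : finType) (G1 : sgraph (vert1 A L T))
    (G2 : sgraph (vert2 B C L T)) (G : sgraph (vertU A B C L T)) :
  twinfree h -> unification_ok h -> composable G1 G2 -> is_split_unification G1 G2 G ->
  induces h G -> induces h G1 \/ induces h G2.
Proof.
move=> tw /exhaustP ok [_ _ [LL TT AT cLc [cAc cTc]] [TC [LB LC] aB [aC aL aT]] LT] [GE1 GE2 AB AC] [v vE].
pose col (x : vertU A B C L T) := match x with
  | inl _ => cA | inr (inl (inl _)) => cB | inr (inl (inr _)) => cC
  | inr (inr (inl _)) => cL | inr (inr (inr _)) => cT end.
pose k i := col (v i).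
have sym := adj_sym G.
have gAB x y : G (inl x) (inr (inl (inl y))) = true := AB x y.
have gAC x y : G (inl x) (inr (inl (inr y))) = false := negbTE (AC x y).
have gAT x y : G (inl x) (inr (inr (inr y))) = false.
  by rewrite (GE1 (inl x) (inr (inr y))); apply/negbTE/AT.
have gLL x y : x != y -> G (inr (inr (inl x))) (inr (inr (inl y))) = true.
  by move=> xy; rewrite (GE1 (inr (inl x)) (inr (inl y))); apply: LL.
have gTT x y : G (inr (inr (inr x))) (inr (inr (inr y))) = false.
  by rewrite (GE1 (inr (inr x)) (inr (inr y))); apply/negbTE/TT.
have gLB x y : G (inr (inr (inl x))) (inr (inl (inl y))) = true.
  by rewrite (GE2 (inr (inl x)) (inl (inl y))); apply: LB.
have gLC x y : G (inr (inr (inl x))) (inr (inl (inr y))) = true.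
  by rewrite (GE2 (inr (inl x)) (inl (inr y))); apply: LC.
have gTC x y : G (inr (inr (inr x))) (inr (inl (inr y))) = false.
  by rewrite (GE2 (inr (inr x)) (inl (inr y))); apply/negbTE/TC.
have gE := (gAB, gAC, gAT, gTT, gLB, gLC, gTC).
have con : consistent None h k.
  apply/all5P => i i5; apply/all5P => j j5; case: eqVneq => //= ij.
  rewrite -vE //; have : v i != v j by rewrite (induces_inj tw vE).
  rewrite /k; case: (v i) (v j) => [x|[[x|x]|[x|x]]] [y|[[y|y]|[y|y]]] //=;
    rewrite ?gE // => xy; try by rewrite sym gE.
  by rewrite gLL //; apply: contraNneq xy => ->.
have kin i : i < 5 -> k i \in colours by rewrite mem_colours.
have g1Ac x : G1 (Some (inl x)) None = false by rewrite adj_sym; apply/negbTE/(cAc tt).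
have g1Tc x : G1 (Some (inr (inr x))) None = false by rewrite adj_sym; apply/negbTE/(cTc tt).
have g1Lc x : G1 (Some (inr (inl x))) None = true by rewrite adj_sym; apply/(cLc tt).
have g2B x : G2 None (Some (inl (inl x))) = true by apply/(aB tt).
have g2C x : G2 None (Some (inl (inr x))) = false by apply/negbTE/(aC tt).
have g2L x : G2 None (Some (inr (inl x))) = false by apply/negbTE/(aL tt).
have g2T x : G2 None (Some (inr (inr x))) = false by apply/negbTE/(aT tt).
have /implyP/(_ con)/orP[/andP[/all5P noB C1]|/andP[A1 /all5P noAL]] :
  consistent None h k ==> unification_case h k := ok k kin.
  left; pose f (x : vertU A B C L T) : vert1 A L T :=
    match x with inl a => Some (inl a) | inr (inr y) => Some (inr y) | _ => None end.
  exists (f \o v) => i j i5 j5 /=; rewrite -vE //.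
  have : k i == cC -> k j == cC -> i = j := at_most_oneP C1 i5 j5.
  have : k i != cB := noB i i5.
  have : k j != cB := noB j j5.
  rewrite /k; case Ei: (v i) => [x|[[x|x]|x]] //; case Ej: (v j) => [y|[[y|y]|y]] //= _ _ CC.
  + by rewrite -GE1.
  + by rewrite g1Ac gE.
  + by rewrite -GE1.
  + by rewrite adj_sym g1Ac sym gE.
  + by move: Ej; rewrite -CC // Ei => -[->]; rewrite !adj_irr.
  + by rewrite adj_sym sym; case: (y) => z; rewrite ?g1Lc ?g1Tc gE.
  + by rewrite -GE1.
  + by case: (x) => z; rewrite ?g1Lc ?g1Tc gE.
  + by rewrite -GE1.
right; pose f (x : vertU A B C L T) : vert2 B C L T :=
  match x with inl _ => None | inr y => Some y end.
exists (f \o v) => i j i5 j5 /=.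
have AA : k i == cA -> k j == cA -> i = j := at_most_oneP A1 i5 j5.
have : [&& k i == cA, k j == cL & h i j] ==> false by have /all5P := noAL i i5; exact.
have : [&& k j == cA, k i == cL & h j i] ==> false by have /all5P := noAL j j5; exact.
rewrite -!vE //; move: AA; rewrite /k; case Ei: (v i) => [x|x]; case Ej: (v j) => [y|y] AA.
+ by move: Ej; rewrite -AA // Ei => -[->]; rewrite !adj_irr.
+ by case: y {Ej AA} => [[y|y]|[y|y]] /=; rewrite ?gE ?g2B ?g2C ?g2L ?g2T //; case: (G _ _).
+ move=> + _; rewrite (adj_sym G2) [RHS]sym.
  by     case: x {Ei AA} => [[x|x]|[x|x]] /=; rewrite ?gE ?g2B ?g2C ?g2L ?g2T //; case: (G _ _).
by rewrite -GE2.
Qed.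

Lemma unification_free (A B C L T : finType) (G1 : sgraph (vert1 A L T))
    (G2 : sgraph (vert2 B C L T)) (G : sgraph (vertU A B C L T)) :
  composable G1 G2 -> is_split_unification G1 G2 G ->
  P5_coP5_free G1 -> P5_coP5_free G2 -> P5_coP5_free G.
Proof.
move=> cmp uni /P5_coP5_freeP[p1 c1] /P5_coP5_freeP[p2 c2]; apply/P5_coP5_freeP.
by split=> /(unification_induces _ _ cmp uni) [] //; vm_compute.
Qed.

(** * Induced pentagons *)

Definition no_P5 (V : finType) (G : sgraph V) :=
  forall a b c d f, G a b -> G b c -> G c d -> G d f ->
  ~~ G a c -> ~~ G a d -> ~~ G a f -> ~~ G b d -> ~~ G b f -> ~~ G c f -> False.

(** The house is the complement of $P_5$; [a], [b], [c], [d], [f] is the order along the path in the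
    complement. The pattern forces the vertices to be distinct. *)
Definition no_house (V : finType) (G : sgraph V) :=
  forall a b c d f, ~~ G a b -> ~~ G b c -> ~~ G c d -> ~~ G d f ->
  G a c -> G a d -> G a f -> G b d -> G b f -> G c f -> False.

Definition C5 (V : finType) (G : sgraph V) a b c d f :=
  [/\ G a b, G b c, G c d, G d f & G f a] /\
  [/\ ~~ G a c, ~~ G b d, ~~ G c f, ~~ G d a & ~~ G f b].

Lemma induces_lt h (V : finType) (G : sgraph V) (v : nat -> V) :
  (forall i, i < 5 -> h i i = false) ->
  (forall i j, h i j = h j i) ->
  (forall i j, i < j < 5 -> G (v i) (v j) = h i j) -> induces h G.
Proof.
move=> h_irr h_sym vE; exists v => i j i5 j5.
case: (ltngtP i j) => [ij|ji|ij]; first by rewrite vE ?ij.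
  by rewrite adj_sym h_sym vE ?ji.
by rewrite ij adj_irr h_irr.
Qed.

Lemma path5C i j : path5 i j = path5 j i.
Proof. by rewrite /path5 orbC. Qed.

Lemma free_no_P5 (V : finType) (G : sgraph V) : P5_coP5_free G -> no_P5 G.
Proof.
move=> /P5_coP5_freeP[p _] a b c d f ab bc cd df ac ad af bd bf cf; apply: p.
apply: (@induces_lt _ _ _ (nth a [:: a; b; c; d; f])).
- by case=> [|[|[|[|[|]]]]].
- exact: path5C.
- by case=> [|[|[|[|[|i]]]]] [|[|[|[|[|j]]]]] //=; rewrite ?andbF //= => _; rewrite /path5 /=; try exact/negbTE.
Qed.

Lemma free_no_house (V : finType) (G : sgraph V) : P5_coP5_free G -> no_house G.
Proof.
move=> /P5_coP5_freeP[_ p] a b c d f ab bc cd df ac ad af bd bf cf; apply: p.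
apply: (@induces_lt _ _ _ (nth a [:: a; b; c; d; f])).
- by case=> [|[|[|[|[|]]]]].
- by move=> i j; rewrite /copath5 path5C eq_sym.
- by case=> [|[|[|[|[|i]]]]] [|[|[|[|[|j]]]]] //=; rewrite ?andbF //= => _; rewrite /copath5 /path5 /=; try exact/negbTE.
Qed.

Lemma C5_rot (V : finType) (G : sgraph V) a b c d f : C5 G a b c d f -> C5 G b c d f a.
Proof. by move=> [[? ? ? ? ?] [? ? ? ? ?]]; split; split=> //; rewrite adj_sym. Qed.

Definition homogeneous (V : finType) (G : sgraph V) (H : {set V}) :=
  forall x y z, x \in H -> y \in H -> z \notin H -> G z x = G z y.

Ltac edge := first [assumption | by rewrite adj_sym].

Section Fouquet.
Variables (V : finType) (G : sgraph V).
Hypotheses (nP : no_P5 G) (nH : no_house G).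
Let sym := adj_sym G.

(* Full, empty, or one of the five patterns of a twin, where the adjacency to
   the twin vertex itself is arbitrary. *)
Definition C5_type (p q r s t : bool) :=
  [|| [&& p, q, r, s & t], ~~ [|| p, q, r, s | t],
   [&& q, ~~ r, ~~ s & t], [&& r, ~~ s, ~~ t & p], [&& s, ~~ t, ~~ p & q],
   [&& t, ~~ p, ~~ q & r] | [&& p, ~~ q, ~~ r & s]].

(** A vertex whose neighbours on the pentagon are a single vertex or two consecutive ones creates a
    $P_5$; four neighbours, or three that are not consecutive, create a house. Up to rotation these
    are all the patterns outside [C5_type]. *)
Lemma C5_type_excluded a b c d f v : C5 G a b c d f ->
  [/\ ~~ [&& G v a, ~~ G v c, ~~ G v d & ~~ G v f],
      ~~ [&& G v a, G v b, G v c, G v d & ~~ G v f]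
    & ~~ [&& G v a, G v b, ~~ G v c, G v d & ~~ G v f]].
Proof.
move=> [[ab bc cd df fa] [ac bd cf da fb]]; split; apply/negP.
- case/and4P=> va vc vd vf; case vb: (G v b); last first.
    by apply: (nP (a := v) (b := a) (c := b) (d := c) (f := d)); try edge; rewrite vb.
  by apply: (nP (a := v) (b := b) (c := c) (d := d) (f := f)); try edge.
- case/and5P=> va vb vc vd vf.
  by apply: (nH (a := v) (b := f) (c := b) (d := d) (f := a)); try edge.
case/and5P=> va vb vc vd vf.
by apply: (nH (a := v) (b := c) (c := a) (d := d) (f := b)); try edge.
Qed.

Lemma C5_typeP a b c d f v : C5 G a b c d f ->
  C5_type (G v a) (G v b) (G v c) (G v d) (G v f).
Proof.
move=> q1; have q2 := C5_rot q1; have q3 := C5_rot q2.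
have q4 := C5_rot q3; have q5 := C5_rot q4.
have [] := C5_type_excluded v q1; have [] := C5_type_excluded v q2.
have [] := C5_type_excluded v q3; have [] := C5_type_excluded v q4.
have [] := C5_type_excluded v q5; rewrite /C5_type.
by case: (G v a); case: (G v b); case: (G v c); case: (G v d); case: (G v f).
Qed.

(* Replacing the vertex a of the pentagon by its twin x changes the adjacency
   of v to at most one vertex of the pentagon; two admissible adjacency
   patterns can differ in one place only if v is a twin of that vertex. *)
Lemma C5_twin a b c d f x v : C5 G a b c d f ->
  C5 G x b c d f -> ~~ [&& G v b, ~~ G v c, ~~ G v d & G v f] -> G v a = G v x.
Proof.
move=> qa qx; have := C5_typeP v qa; have := C5_typeP v qx; rewrite /C5_type.
by case: (G v a); case: (G v b); case: (G v c); case: (G v d); case: (G v f); case: (G v x).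
Qed.

Lemma twins_homogeneous a b c d f : C5 G a b c d f ->
  homogeneous G [set x | [&& G x b, ~~ G x c, ~~ G x d & G x f]].
Proof.
move=> q5 x y z; rewrite !inE => hx hy hz.
suff tw w : [&& G w b, ~~ G w c, ~~ G w d & G w f] -> G z a = G z w.
  by rewrite -(tw _ hx) -(tw _ hy).
case/and4P=> wb wc wd wf; apply: (C5_twin q5 _ hz).
have [[ab bc cd df fa] [ac bd cf da fb]] := q5.
by split; split=> //; edge.
Qed.

(** A twin class with at least two elements is homogeneous, and proper since it misses a neighbour
    of its pentagon vertex. If all five classes are singletons, every vertex off the pentagon is
    complete or anticomplete to it, so the pentagon is homogeneous unless it spans the graph. *)
Lemma C5_homogeneous a b c d f : C5 G a b c d f ->
  (exists H : {set V}, [/\ homogeneous G H, 1 < #|H| & #|H| < #|V|]) \/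
  (forall x, x \in [:: a; b; c; d; f]).
Proof.
move=> q1.
have step a' b' c' d' f' : C5 G a' b' c' d' f' ->
  (exists H : {set V}, [/\ homogeneous G H, 1 < #|H| & #|H| < #|V|]) \/
  (forall x, [&& G x b', ~~ G x c', ~~ G x d' & G x f'] -> x = a').
  move=> q; have hom := twins_homogeneous q; set H := finset _ in hom.
  have [[ab bc cd df fa] [ac bd cf da fb]] := q.
  have a'H : a' \in H by rewrite inE; apply/and4P; split; edge.
  have [/eqP|gt1] := eqVneq #|H| 1.
    case/cards1P=> y Hy; right=> x Hx; have : x \in H by rewrite inE.
    by move: a'H; rewrite Hy !inE => /eqP-> /eqP.
  left; exists H; split=> //.
    by rewrite ltn_neqAle eq_sym gt1; apply/card_gt0P; exists a'.
  rewrite ltn_neqAle max_card andbT; apply/negP => /eqP HV.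
  have HT : H = setT by apply/eqP; rewrite eqEcard subsetT cardsT HV /=.
  by have := in_setT b'; rewrite -HT inE adj_irr.
have q2 := C5_rot q1; have q3 := C5_rot q2.
have q4 := C5_rot q3; have q5 := C5_rot q4.
have [|ta] := step _ _ _ _ _ q1; first by left.
have [|tb] := step _ _ _ _ _ q2; first by left.
have [|tc] := step _ _ _ _ _ q3; first by left.
have [|td] := step _ _ _ _ _ q4; first by left.
have [|tf] := step _ _ _ _ _ q5; first by left.
pose Q := [set x in [:: a; b; c; d; f]].
have uni v : v \notin Q -> forall x, x \in Q -> G v x = G v a.
  rewrite !inE !negb_or => /and5P[va vb vc vd vf] x; rewrite !inE.
  have := C5_typeP v q1; rewrite /C5_type.
  have /negbTE-> : ~~ [&& G v b, ~~ G v c, ~~ G v d & G v f].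
    by apply: contraNN va => /ta ->.
  have /negbTE-> : ~~ [&& G v c, ~~ G v d, ~~ G v f & G v a].
    by apply: contraNN vb => /tb ->.
  have /negbTE-> : ~~ [&& G v d, ~~ G v f, ~~ G v a & G v b].
    by apply: contraNN vc => /tc ->.
  have /negbTE-> : ~~ [&& G v f, ~~ G v a, ~~ G v b & G v c].
    by apply: contraNN vd => /td ->.
  have /negbTE-> : ~~ [&& G v a, ~~ G v b, ~~ G v c & G v d].
    by apply: contraNN vf => /tf ->.
  rewrite !orbF => pat xQ; case/or4P: xQ pat => [|||/orP[]] /eqP-> //;
  by case: (G v a); case: (G v b); case: (G v c); case: (G v d); case: (G v f).
have [QV|QV] := eqVneq #|Q| #|V|.
  have QT : Q = setT by apply/eqP; rewrite eqEcard subsetT cardsT QV /=.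
  by right=> x; have := in_setT x; rewrite -QT !inE.
left; exists Q; split.
- by move=> x y z xQ yQ zQ; rewrite (uni z) ?(uni z zQ y).
- apply/card_gt1P; exists a, b; rewrite !inE !eqxx ?orbT; split=> //.
  by have [[ab _ _ _ _] _] := q1; apply: contraTneq ab => ->; rewrite adj_irr.
by rewrite ltn_neqAle QV max_card.
Qed.

End Fouquet.

(** * The theorem of Foldes and Hammer *)

Definition no_2K2 (V : finType) (G : sgraph V) :=
  forall a b c d, G a b -> G c d -> ~~ G a c -> ~~ G a d -> ~~ G b c -> ~~ G b d -> False.

Section FoldesHammer.
Variables (V : finType) (G : sgraph V).
Hypotheses (n2K2 : no_2K2 G) (n2K2' : no_2K2 (compl G)).
Hypothesis nC5 : forall a b c d f, ~ C5 G a b c d f.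
Let sym := adj_sym G.

Let nC4 a b c d : G a b -> G b c -> G c d -> G d a -> ~~ G a c -> ~~ G b d ->
  a != c -> b != d -> False.
Proof.
move=> ab bc cd da ac bd nac nbd.
have h x y : G x y -> ~~ compl G x y by rewrite complE negb_and orbC => ->.
by apply: (n2K2' (a := a) (b := c) (c := b) (d := d)); rewrite ?complE ?nac ?nbd //;
  apply: h; rewrite // sym.
Qed.

Let clique (K : {set V}) := [forall x in K, forall y in K, (x != y) ==> G x y].

Let cliqueP K : reflect (is_clique G K) (clique K).
Proof.
apply: (iffP forall_inP) => [h x y xK yK xy | h x xK].
  by have /forall_inP/(_ y yK)/implyP/(_ xy) := h x xK.
by apply/forall_inP => y yK; apply/implyP; apply: h.
Qed.

Let clique_add K x : is_clique G K -> (forall y, y \in K -> G x y) -> is_clique G (x |: K).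
Proof.
move=> cK xK y z /setU1P[->|yK] /setU1P[->|zK]; rewrite ?eqxx // => yz.
- exact: xK.
- by rewrite sym xK.
- exact: cK.
Qed.

(** Among the maximum cliques, let [K] have the largest degree sum. An edge [x y] outside [K] would
    allow one vertex [u] of [K] to be traded for two, [y] and some neighbour [w] of [u],
    contradicting maximality. *)
Theorem Foldes_Hammer : is_split G.
Proof.
have c0 : clique set0 by apply/cliqueP => x y; rewrite inE.
have [K0 cK0 K0max] := @arg_maxnP _ set0 clique (fun K => #|K|) c0.
pose deg x := #|[set z | G x z]|.
have cK0' : clique K0 && (#|K0| == #|K0|) by rewrite cK0 eqxx.
have [K /andP[/cliqueP cK /eqP szK] Kmax] := @arg_maxnP _ K0
  (fun K => clique K && (#|K| == #|K0|)) (fun K => \sum_(x in K) deg x) cK0'.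
have card_le K' : is_clique G K' -> #|K'| <= #|K| by move/cliqueP/K0max; rewrite szK.
exists K, (~: K); split=> //; [by rewrite setUCr | by rewrite setICr|].
move=> x y; rewrite !inE => xK yK; apply/negP => xy.
pose N z := [set k in K | ~~ G z k].
(* If the non-neighbourhoods in [K] are not nested, the witnesses [v] and [u] of this close the
   induced 4-cycle [x], [y], [v], [u]. *)
wlog Nsub : x y xK yK xy / N x \subset N y.
  move=> h; case: (boolP (N x \subset N y)) => [|/subsetPn[v]]; first exact: h.
  case: (boolP (N y \subset N x)) => [s _ _|/subsetPn[u]].
    by apply: (h y x) => //; rewrite sym.
  rewrite !inE => /andP[uK yu]; rewrite uK negbK => /= xu /andP[vK xv].
  rewrite vK negbK => /= yv.
  apply: (nC4 (a := x) (b := y) (c := v) (d := u)) => //.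
  - by apply: cK => //; apply: contraNneq xv => ->.
  - by rewrite sym.
  - by apply: contraNneq xK => ->.
  - by apply: contraNneq yK => ->.
have [u /andP[uK xu]] : exists u, (u \in K) && ~~ G x u.
  apply/existsP; apply: contraT => /existsPn noN.
  have /card_le : is_clique G (x |: K).
    by apply: clique_add => // k kK; have := noN k; rewrite kK negbK.
  by rewrite cardsU1 xK ltnn.
have yu : ~~ G y u by have /subsetP/(_ u) := Nsub; rewrite !inE uK => /(_ xu).
(* A second non-neighbour [k] of [x] in [K] would also be one of [y], and [x y], [u k] would be a
   2K2. *)
have xK' k : k \in K -> k != u -> G x k.
  move=> kK ku; apply: contraT => xk; exfalso.
  apply: (n2K2 (a := x) (b := y) (c := u) (d := k)) => //.
    by apply: cK => //; rewrite eq_sym.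
  by have /subsetP/(_ k) := Nsub; rewrite !inE kK => /(_ xk).
have uK' k : k \in K -> k != u -> G u k by move=> kK ku; apply: cK; rewrite // eq_sym.
have cKu : is_clique G (K :\ u) by move=> k l /setD1P[_ kK] /setD1P[_ lK]; apply: cK.
(* Exchanging [u] for [x] gives another maximum clique, whose degree sum is not larger. *)
have degxu : deg x <= deg u.
  have cx : is_clique G (x |: K :\ u).
    by apply: clique_add => // k /setD1P[ku kK]; apply: xK'.
  have xKu : x \notin K :\ u by rewrite !inE (negPf xK) andbF.
  have := Kmax (x |: K :\ u); rewrite /= cardsU1 xKu add1n.
  have /eqP := cardsD1 u K; rewrite uK add1n -szK => /eqP <-; rewrite eqxx andbT.
  move=> /(_ (introT (cliqueP _) cx)); rewrite big_setU1 //=.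
  by rewrite [X in _ <= X](big_setD1 u) //= leq_add2r.
(* Otherwise all neighbours of [u] are neighbours of [x], while [y] is a neighbour of [x] only, so
   [deg u < deg x]. *)
have [w /andP[uw xw]] : exists w, G u w && ~~ G x w.
  apply/existsP; apply: contraLR degxu => /existsPn h; rewrite -ltnNge.
  apply/proper_card/properP; split; last by exists y; rewrite !inE // sym.
  by apply/subsetP => w; rewrite !inE => uw; have := h w; rewrite uw negbK.
have wK : w \notin K.
  apply: contraNN xw => wK; apply: xK' => //.
  by apply: contraTneq uw => ->; rewrite adj_irr.
have wx : w != x by apply: contraNneq xu => <-; rewrite sym.
have uy : u != y by apply: contraNneq yK => <-.
have yw : G y w.
  apply: contraT => yw; exfalso.
  by apply: (n2K2 (a := x) (b := y) (c := u) (d := w)).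
(* If exactly one of [y] and [w] misses [k] there is an induced 4-cycle; if both do, [u], [w], [y],
   [x], [k] is a pentagon. *)
have wk k : k \in K -> k != u -> G y k && G w k.
  move=> kK ku; have xk := xK' k kK ku; have uk := uK' k kK ku.
  case yk: (G y k); case wk: (G w k) => //=; exfalso.
  - apply: (nC4 (a := u) (b := w) (c := y) (d := k)); rewrite ?wk //; try edge.
    by apply: contraNneq wK => ->.
  - apply: (nC4 (a := w) (b := y) (c := x) (d := k)); rewrite ?yk //; try edge.
    by apply: contraNneq yK => ->.
  - apply: (nC5 (a := u) (b := w) (c := y) (d := x) (f := k)).
    by split; split; rewrite ?yk ?wk //; try edge; rewrite sym ?yk ?wk.
have /card_le : is_clique G (w |: (y |: K :\ u)).
  apply: clique_add; first apply: clique_add => //.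
    by move=> k /setD1P[ku kK]; have /andP[] := wk k kK ku.
  by move=> k /setU1P[->|/setD1P[ku kK]]; [rewrite sym | have /andP[] := wk k kK ku].
have := cardsD1 u K; rewrite uK add1n => ->.
rewrite !cardsU1 !inE (negPf wK) (negPf yK) !andbF orbF.
suff -> : w != y by rewrite !add1n ltnn.
by apply: contraTneq yw => ->; rewrite adj_irr.
Qed.

End FoldesHammer.

(** * Split divides from maximal separated pairs *)

Section Connected.
Variables (V : finType) (G : sgraph V).

(** Connectedness by cuts instead of paths: later arguments need exactly the edge that crosses a
    cut. *)
Definition connected (S : {set V}) :=
  [forall T : {set V}, (S :&: T != set0) ==> (S :\: T != set0) ==>
    [exists x in S :&: T, exists y in S :\: T, G x y]].

Lemma connectedP (S : {set V}) : reflect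
  (forall (T : {set V}) x y, x \in S -> x \in T -> y \in S -> y \notin T ->
    exists x' y', [/\ x' \in S, x' \in T, y' \in S, y' \notin T & G x' y'])
  (connected S).
Proof.
apply: (iffP forallP) => [h T x y xS xT yS yT | h T].
  have /implyP/(_ _)/implyP/(_ _)/exists_inP[||x' /setIP[x'S x'T]] := h T.
  - by apply/set0Pn; exists x; rewrite inE xS.
  - by apply/set0Pn; exists y; rewrite inE yS yT.
  by move=> /exists_inP[y' /setDP[y'S y'T] xy]; exists x', y'.
apply/implyP => /set0Pn[x /setIP[xS xT]]; apply/implyP => /set0Pn[y /setDP[yS yT]].
have [x' [y' [x'S x'T y'S y'T xy]]] := h T x y xS xT yS yT.
apply/exists_inP; exists x'; first by rewrite inE x'S.
by apply/exists_inP; exists y'; rewrite // inE y'S y'T.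
Qed.

Lemma connected1 x : connected [set x].
Proof. by apply/connectedP => T y z /set1P-> xT /set1P->; rewrite xT. Qed.

Lemma connectedU (S D : {set V}) : connected S ->
  (forall d, d \in D -> exists2 s, s \in S & G s d) -> connected (S :|: D).
Proof.
move=> /connectedP cS hD; apply/connectedP => T x y xSD xT ySD yT.
case: (boolP [exists s in S, s \in T]) => [/exists_inP[s sS sT] | noT].
  case: (boolP [exists t in S, t \notin T]) => [/exists_inP[t tS tT] | allT].
    have [x' [y' [? ? ? ? ?]]] := cS T s t sS sT tS tT.
    by exists x', y'; split; rewrite // inE; apply/orP; left.
  have ST t : t \in S -> t \in T.
    by move=> tS; apply: contraNT allT => tT; apply/exists_inP; exists t.
  move: (ySD); rewrite inE => /orP[/ST|yD]; first by rewrite (negPf yT).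
  have [t tS ty] := hD y yD; exists t, y; split=> //; last exact: ST.
  by rewrite inE tS.
have ST t : t \in S -> t \notin T.
  by move=> tS; apply: contraNN noT => tT; apply/exists_inP; exists t.
move: (xSD); rewrite inE => /orP[/ST|xD]; first by rewrite xT.
have [t tS tx] := hD x xD; exists x, t; split=> //.
- by rewrite inE tS.
- exact: ST.
- by rewrite adj_sym.
Qed.

Definition anti (A : {set V}) := [set x | (x \notin A) && [forall a in A, ~~ G x a]].
Definition full (A : {set V}) := [set x | (x \notin A) && [forall a in A, G x a]].
Definition mixed (A : {set V}) :=
  [set x | [&& x \notin A, [exists a in A, G x a] & [exists a in A, ~~ G x a]]].
Definition core (A : {set V}) := [set x in anti A | [exists y in anti A, G x y]].

Lemma antiP (A : {set V}) x : reflect (x \notin A /\ forall a, a \in A -> ~~ G x a) (x \in anti A).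
Proof. by rewrite inE; apply: (iffP andP) => -[xA /forall_inP]. Qed.

Lemma fullP (A : {set V}) x : reflect (x \notin A /\ forall a, a \in A -> G x a) (x \in full A).
Proof. by rewrite inE; apply: (iffP andP) => -[xA /forall_inP]. Qed.

Lemma mixedP (A : {set V}) x : reflect
  [/\ x \notin A, exists2 a, a \in A & G x a & exists2 a, a \in A & ~~ G x a]
  (x \in mixed A).
Proof. by rewrite inE; apply: (iffP and3P) => -[xA /exists_inP ? /exists_inP ?]. Qed.

Lemma coreP (A : {set V}) x : reflect (x \in anti A /\ exists2 y, y \in anti A & G x y) (x \in core A).
Proof. by rewrite [X in reflect _ X]in_set; apply: (iffP andP) => -[xA /exists_inP]. Qed.

Lemma trichotomy (A : {set V}) x : [|| x \in A, x \in anti A, x \in full A | x \in mixed A].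
Proof.
rewrite !inE; case: (x \in A) => //=.
case: (boolP [forall a in A, ~~ G x a]) => //= /forall_inPn[a aA].
rewrite negbK => xa; case: (boolP [forall a in A, G x a]) => //= /forall_inPn[b bA xb].
by apply/andP; split; apply/exists_inP; [exists a | exists b].
Qed.

(* With B = full A, C = core A, L = mixed A and T = anti A minus core A,
   this says that (A, B, C, L, T) presents G as a split graph unification. *)
Definition split_divide (A : {set V}) :=
  [/\ 1 < #|A|, exists c, c \in core A, {in mixed A &, forall x y, x != y -> G x y},
      {in mixed A & full A, forall x y, G x y} & {in mixed A & core A, forall x y, G x y}].

(** Disjointness follows: a common vertex would have a neighbour in [C], yet [A] is anticomplete to
    [C]. *)
Definition separated (A C : {set V}) :=
  [&& connected A, 1 < #|A|, C != set0, [forall c in C, exists c' in C, G c c']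
    & [forall a in A, forall c in C, ~~ G a c]].

Lemma separatedP (A C : {set V}) : reflect
  [/\ connected A, 1 < #|A|, exists c, c \in C, forall c, c \in C -> exists2 c', c' \in C & G c c'
    & forall a c, a \in A -> c \in C -> ~~ G a c]
  (separated A C).
Proof.
apply: (iffP and5P) => -[h1 h2 h3 h4 h5]; split=> //.
- exact/set0Pn.
- by move=> c cC; have /exists_inP := forall_inP h4 c cC.
- by move=> a c aA cC; have /forall_inP/(_ c cC) := forall_inP h5 a aA.
- exact/set0Pn.
- by apply/forall_inP => c cC; apply/exists_inP/h4.
- by apply/forall_inP => a aA; apply/forall_inP => c cC; apply: h5.
Qed.

End Connected.

(** * Adjacencies around a maximal separated pair *)

Section MaximalPair.
Variables (V : finType) (G : sgraph V).
Hypotheses (nP : no_P5 G) (nH : no_house G).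
Hypothesis nC5 : forall a b c d f, ~ C5 G a b c d f.
Variables A C : {set V}.
Hypothesis sepAC : separated G A C.
Hypothesis maxAC : forall A' C', separated G A' C' -> #|A'| + #|C'| <= #|A| + #|C|.
Hypothesis maxAC' : forall A' C', separated (compl G) A' C' -> #|A'| + #|C'| <= #|A| + #|C|.
Let sym := adj_sym G.

Let connA : connected G A. Proof. by case/separatedP: sepAC. Qed.
Let A2 : 1 < #|A|. Proof. by case/separatedP: sepAC. Qed.
Let C0 : exists c, c \in C. Proof. by case/separatedP: sepAC. Qed.
Let Cnbr c : c \in C -> exists2 c', c' \in C & G c c'.
Proof. by case/separatedP: sepAC => ? ? ? + ?; apply. Qed.
Let AC a c : a \in A -> c \in C -> ~~ G a c.
Proof. by case/separatedP: sepAC => ? ? ? ?; apply. Qed.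
Let A0 : exists a, a \in A. Proof. by apply/card_gt0P; apply: ltnW. Qed.
Let CA x : x \in C -> x \notin A.
Proof. by move=> xC; apply/negP => xA; have [c cC] := Cnbr xC; rewrite (negPf (AC xA cC)). Qed.

(** The vertices anticomplete to [A] beyond [C]; by maximality of the pair they turn out to be
    stable and anticomplete to [C]. *)
Let I := [set v | [&& v \notin A, v \notin C & [forall a in A, ~~ G v a]]].

(** Otherwise [v] could be added to [A]. *)
Let nbrA_nbrC v : v \notin A -> v \notin C -> (exists2 a, a \in A & G v a) ->
  exists2 c, c \in C & G v c.
Proof.
move=> vA vC [a aA va]; apply/exists_inP; apply: contraT => /exists_inPn noC.
have /maxAC : separated G (A :|: [set v]) C.
  apply/separatedP; split=> //.
  - by apply: connectedU => // d /set1P->; exists a; rewrite // sym.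
  - by apply: leq_trans A2 _; apply/subset_leq_card/subsetUl.
  - by move=> b c /setUP[bA|/set1P->] cC; [apply: AC | apply: noC].
by rewrite setUC cardsU1 vA add1n addSn ltnn.
Qed.

(** Otherwise [v] could be added to [C]. *)
Let nbrC_nbrA v : v \notin A -> v \notin C -> (exists2 c, c \in C & G v c) ->
  exists2 a, a \in A & G v a.
Proof.
move=> vA vC [c cC vc]; apply/exists_inP; apply: contraT => /exists_inPn noA.
have /maxAC : separated G A (v |: C).
  apply/separatedP; split=> //.
  - by exists v; rewrite setU11.
  - move=> d /setU1P[->|dC]; first by exists c; rewrite // setU1r.
    by have [c' c'C dc'] := Cnbr dC; exists c'; rewrite // setU1r.
  - by move=> a d aA /setU1P[->|dC]; [rewrite sym noA | apply: AC].
by rewrite cardsU1 vC add1n addnS ltnn.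
Qed.

Let IP v : reflect [/\ v \notin A, v \notin C & forall a, a \in A -> ~~ G v a] (v \in I).
Proof. by rewrite inE; apply: (iffP and3P) => -[? ? /forall_inP]. Qed.

Let IC v c : v \in I -> c \in C -> ~~ G v c.
Proof.
move=> /IP[vA vC noA] cC; apply/negP => vc.
have [|a aA va] := nbrC_nbrA vA vC; first by exists c.
by have := noA a aA; rewrite va.
Qed.

(** Both ends of an edge inside [I] could be added to [C]. *)
Let I_stable v w : v \in I -> w \in I -> ~~ G v w.
Proof.
move=> vI wI; apply/negP => vw; have [vA vC noA] := IP _ vI; have [wA wC noA'] := IP _ wI.
have /maxAC : separated G A (v |: (w |: C)).
  apply/separatedP; split=> //.
  - by exists v; rewrite setU11.
  - move=> d /setU1P[->|/setU1P[->|dC]].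
    + by exists w; rewrite // !inE eqxx orbT.
    + by exists v; rewrite 1?sym // !inE eqxx.
    + by have [c' c'C dc'] := Cnbr dC; exists c'; rewrite // !inE c'C !orbT.
  - by move=> a d aA /setU1P[->|/setU1P[->|dC]]; [rewrite sym noA | rewrite sym noA' | apply: AC].
have vw' : v != w by apply: contraTneq vw => ->; rewrite adj_irr.
by rewrite !cardsU1 !inE (negPf vC) (negPf wC) (negPf vw') /= !add1n !addnS => /ltnW; rewrite ltnn.
Qed.

Let notC_nbrA v : (exists2 a, a \in A & G v a) -> v \notin C.
Proof. by move=> [a aA va]; apply/negP => vC; have := AC aA vC; rewrite sym va. Qed.

Let mixed_edge v : v \in mixed G A -> exists y z, [/\ y \in A, z \in A, G v y, ~~ G v z & G y z].
Proof.
move=> /mixedP[vA [y yA vy] [z zA vz]].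
have /connectedP/(_ [set x | G v x] y z yA) := connA.
rewrite !inE => /(_ vy zA vz)[y' [z' []]]; rewrite !inE => ? ? ? ? ?.
by exists y', z'.
Qed.

(** Let [C1] and [C2] be the neighbours and non-neighbours of [v] in [C]. An edge between them would
    extend [z], [y], [v] to a $P_5$, where [y z] is an edge of [A] split by [v]. Hence, if [C2] is
    non-empty, moving [v] and [C1] over to [A] gives a separated pair with one more vertex. *)
Let mixedC v c : v \in mixed G A -> c \in C -> G v c.
Proof.
move=> vL cC; apply: contraT => vc; exfalso.
have [y [z [yA zA vy vz yz]]] := mixed_edge vL.
have [vA nbr _] := mixedP _ _ _ vL; have vC := notC_nbrA nbr.
pose C1 := [set x in C | G v x]; pose C2 := [set x in C | ~~ G v x].
have C12 c1 c2 : c1 \in C1 -> c2 \in C2 -> ~~ G c1 c2.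
  rewrite !inE => /andP[c1C vc1] /andP[c2C vc2]; apply/negP => c12.
  by apply: (nP (a := z) (b := y) (c := v) (d := c1) (f := c2)) => //; try edge; exact: AC.
have /maxAC : separated G (A :|: [set v] :|: C1) C2.
  apply/separatedP; split.
  - apply: connectedU; first by apply: connectedU => // d /set1P->; exists y; rewrite // sym.
    by move=> d; rewrite inE => /andP[_ vd]; exists v; rewrite // !inE eqxx orbT.
  - by apply: leq_trans A2 _; apply/subset_leq_card; rewrite -setUA subsetUl.
  - by exists c; rewrite inE cC.
  - move=> d dC2; move: (dC2); rewrite inE => /andP[dC vd]; have [e eC de] := Cnbr dC.
    exists e => //; rewrite inE eC /=; apply/negP => ve.
    have /C12/(_ dC2) : e \in C1 by rewrite inE eC.
    by rewrite sym de.
  - move=> a d; rewrite !in_setU => /orP[/orP[aA|/set1P->]|aC1] dC2; last exact: C12.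
      by move: dC2; rewrite inE => /andP[dC _]; apply: AC.
    by move: dC2; rewrite inE => /andP[].
have -> : #|A :|: [set v] :|: C1| = #|A| + 1 + #|C1|.
  rewrite cardsU disjoint_setI0 ?cards0 ?subn0; last first.
    apply/pred0P => x /=; apply/negP; rewrite !inE => /andP[/orP[xA|/eqP->] /andP[xC]].
      by rewrite (negPf (CA xC)) in xA.
    by rewrite adj_irr.
  by rewrite setUC cardsU1 vA (addnC 1).
have : #|C1| + #|C2| = #|C|.
  by rewrite -cardsUI; have -> : C1 :&: C2 = set0; [| rewrite cards0 addn0];
    [apply/setP | congr #|pred_of_set _|; apply/setP] => x; rewrite !inE;
    case: (x \in C); case: (G v x).
by move=> <-; rewrite -!addnA leq_add2l add1n ltnn.
Qed.

Let full_nbrC b : b \in full G A -> exists2 c, c \in C & G b c.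
Proof.
move=> /fullP[bA bfull]; have [a aA] := A0; have nbr : exists2 a, a \in A & G b a.
  by exists a; rewrite // bfull.
by apply: nbrA_nbrC => //; apply: notC_nbrA.
Qed.

(** With an edge [y z] of [A] split by [l] and a neighbour [c] of [b] in [C], non-adjacent [l] and
    [b] would form a house. *)
Let mixed_full l b : l \in mixed G A -> b \in full G A -> G l b.
Proof.
move=> lL bB; have [c cC bc] := full_nbrC bB; have [bA bfull] := fullP _ _ _ bB.
have [y [z [yA zA ly lz yz]]] := mixed_edge lL.
have lc := mixedC lL cC; apply: contraT => lb; exfalso.
apply: (nH (a := b) (b := l) (c := z) (d := c) (f := y)) => //; try edge; try exact: AC.
- by rewrite sym AC.
- exact: bfull.
- exact: bfull.
Qed.

(** Otherwise take an edge [x y] of [A] leaving the set of vertices seen by [l] but not by [l'].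
    With a vertex [c] of [C] it gives a house, a pentagon or a $P_5$, according to the adjacency of
    [y] to [l] and [l']. *)
Let mixed_nonadj l l' a : l \in mixed G A -> l' \in mixed G A -> ~~ G l l' ->
  a \in A -> G l a -> G l' a.
Proof.
move=> lL l'L ll' aA la; apply: contraT => l'a; exfalso.
have [lA _ [z zA lz]] := mixedP _ _ _ lL; have [c cC] := C0.
have lc := mixedC lL cC; have l'c := mixedC l'L cC.
have /connectedP/(_ [set x | G l x && ~~ G l' x] a z aA) := connA.
rewrite !inE la l'a (negPf lz) /= => /(_ isT zA isT)[x [y []]].
rewrite !inE => xA /andP[lx l'x] yA; rewrite negb_and negbK => nxy xy.
have cx := AC xA cC; have cy := AC yA cC.
case ly: (G l y); first (rewrite ly /= in nxy).
  by apply: (nH (a := l) (b := l') (c := x) (d := c) (f := y)); edge.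
case l'y: (G l' y).
  by apply: (@nC5 l x y l' c); split; split; rewrite ?ly //; try edge.
by apply: (nP (a := y) (b := x) (c := l) (d := c) (f := l'));
  rewrite // sym ?ly ?l'y // sym.
Qed.

(** As [I] is stable and anticomplete to [C], the core of [A] lies inside [C], so the facts about
    [C] apply to it. *)
Let mixed_clique_divide : {in mixed G A &, forall x y, x != y -> G x y} -> split_divide G A.
Proof.
move=> Lcl.
have Canti c : c \in C -> c \in anti G A.
  by move=> cC; apply/antiP; split=> [|a aA]; [exact: CA | rewrite sym AC].
have antiI x : x \in anti G A -> x \in C \/ x \in I.
  move=> /antiP[xA hx]; case: (boolP (x \in C)) => xC; [by left | right].
  by apply/IP.
have coreC x : x \in core G A -> x \in C.
  move=> /coreP[/antiI[//|xI] [y /antiI[yC|yI]]]; first by rewrite (negPf (IC xI yC)).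
  by rewrite (negPf (I_stable xI yI)).
split=> //.
- have [c cC] := C0; exists c; have [c' c'C cc'] := Cnbr cC.
  by apply/coreP; split; [exact: Canti | exists c'; first exact: Canti].
- by move=> x c xL /coreC; apply: mixedC.
Qed.

Let anticomponent (M : {set V}) :=
  [&& M \subset mixed G A, connected (compl G) M, 1 < #|M|
    & [forall x in M, forall y in mixed G A :\: M, G x y]].

Let anticomponentP (M : {set V}) : reflect
  [/\ {subset M <= mixed G A}, connected (compl G) M, 1 < #|M|
    & forall x y, x \in M -> y \in mixed G A -> y \notin M -> G x y] (anticomponent M).
Proof.
apply: (iffP and4P) => -[h1 h2 h3 h4]; split=> //; first exact/subsetP.
- by move=> x y xM yL yM; have /forall_inP/(_ y) := forall_inP h4 x xM; apply; rewrite inE yL yM.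
- exact/subsetP.
- by apply/forall_inP => x xM; apply/forall_inP => y /setDP[yL yM]; apply: h4.
Qed.

(** Take a maximal set of mixed vertices containing both and connected in the complement; a mixed
    vertex outside it with a non-neighbour inside could be added. *)
Let anticomponent_exists w w' : w \in mixed G A -> w' \in mixed G A -> w != w' -> ~~ G w w' ->
  exists M, [/\ anticomponent M, w \in M & w' \in M].
Proof.
move=> wL w'L ww' nww'.
pose P (M : {set V}) := [&& M \subset mixed G A, connected (compl G) M, w \in M & w' \in M].
have P0 : P ([set w] :|: [set w']).
  apply/and4P; split; rewrite ?inE ?eqxx ?orbT //.
    by apply/subsetP => x; rewrite !inE => /orP[]/eqP->; [move: wL | move: w'L]; rewrite inE.
  apply: connectedU; first exact: connected1.
  by move=> d /set1P->; exists w; rewrite ?set11 // complE ww' nww'.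
have [M /maxsetP[/and4P[/subsetP ML Mconn wM w'M] Mmax] _] := maxset_exists P0.
exists M; split=> //; apply/anticomponentP; split=> //.
  by apply/card_gt1P; exists w, w'.
move=> x y xM yL yM; apply: contraT => xy.
have xy' : x != y by apply: contraNneq yM => <-.
suff /Mmax/(_ (subsetUl _ _)) yMM : P (M :|: [set y]).
  by move: yM; rewrite -yMM !inE eqxx orbT.
rewrite /P !in_setU wM w'M !andbT; apply/andP; split.
  by apply/subsetP => z /setUP[/ML|/set1P->].
by apply: connectedU => // d /set1P->; exists x; rewrite // complE xy' xy.
Qed.

(** * The split divide of the complement given by an anticomponent *)

Section Anticomponent.
Variable M : {set V}.
Hypothesis Mcomp : anticomponent M.
Hypothesis Mmax : forall M', anticomponent M' ->
  #|[set i in I | [forall m in M', G i m]]| <= #|[set i in I | [forall m in M, G i m]]|.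

Let ML m : m \in M -> m \in mixed G A.
Proof. by case/anticomponentP: Mcomp => + _ _ _; apply. Qed.
Let Mconn : connected (compl G) M.
Proof. by case/anticomponentP: Mcomp. Qed.
Let M2 : 1 < #|M|.
Proof. by case/anticomponentP: Mcomp. Qed.
Let MLM x y : x \in M -> y \in mixed G A -> y \notin M -> G x y.
Proof. by case/anticomponentP: Mcomp => _ _ _; apply. Qed.
Let M0 : exists m, m \in M. Proof. by apply/card_gt0P; apply: ltnW. Qed.
Let MA m : m \in M -> m \notin A.
Proof. by move=> /ML/mixedP[]. Qed.
Let MC m : m \in M -> m \notin C.
Proof. by move=> /ML/mixedP[_ h _]; apply: notC_nbrA. Qed.

(** Connectedness of [N] in the complement, applied to the neighbourhood of [x], yields a non-edge
    of [G] crossing it. *)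
Let split_nonadj (N : {set V}) x p q : connected (compl G) N -> p \in N -> q \in N ->
  G x p -> ~~ G x q -> exists p' q',
  [/\ p' \in N, q' \in N, G x p', ~~ G x q' & [/\ p' != q' & ~~ G p' q']].
Proof.
move=> /connectedP cN pN qN xp xq.
have := cN [set z | G x z] p q pN; rewrite !inE => /(_ xp qN xq)[p' [q' []]].
by rewrite !inE complE => ? ? ? ? /andP[? ?]; exists p', q'.
Qed.

(** Non-adjacent mixed vertices have the same neighbours in [A], and [M] is held together by
    non-edges. *)
Let A_uniform a m m' : a \in A -> m \in M -> m' \in M -> G a m -> G a m'.
Proof.
move=> aA mM m'M am; apply: contraT => am'.
have [p [q [pM qM ap aq [_ pq]]]] := split_nonadj Mconn mM m'M am am'.
by move: aq; rewrite sym (mixed_nonadj (ML pM) (ML qM) pq aA) // sym.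
Qed.

Let C_fullM c m : c \in C -> m \in M -> G c m.
Proof. by move=> cC mM; rewrite sym mixedC // ML. Qed.

Let outside x : [|| x \in A, x \in C, x \in full G A, x \in mixed G A | x \in I].
Proof.
have := trichotomy G A x; case/or4P=> [->||->|->]; rewrite ?orbT //.
move=> /antiP[xA hx]; case: (boolP (x \in C)) => xC; rewrite ?orbT //.
by have -> : x \in I by [apply/IP]; rewrite !orbT.
Qed.

(** All of [C], all of [full G A] and the mixed vertices outside [M] are complete to [M]. *)
Let nonfullM x m : x \notin M -> m \in M -> ~~ G x m -> x \in A \/ x \in I.
Proof.
move=> xM mM; have /orP[xA|/or4P[xC|xB|xL|xI]] := outside x; [by left | | | | by right].
- by rewrite C_fullM.
- by rewrite sym mixed_full // ML.
- by rewrite sym MLM.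
Qed.

(** A vertex of [A] is complete or anticomplete to [M] by [A_uniform], which leaves only [I]. *)
Let mixedM_I i : i \in mixed (compl G) M -> i \in I.
Proof.
move=> /mixedP[iM [m mM] /andP[_ im] [m' m'M]].
have nim' : i != m' by apply: contraNneq iM => ->.
rewrite complE nim' negbK /= => im'.
have [iA|//] := nonfullM iM mM im.
by rewrite (A_uniform iA m'M mM) in im.
Qed.

Let mixedM_nbrs i : i \in mixed (compl G) M ->
  exists p q, [/\ p \in M, q \in M, G i p, ~~ G i q & ~~ G p q].
Proof.
move=> /mixedP[iM [m mM] /andP[_ im] [m' m'M]].
have nim' : i != m' by apply: contraNneq iM => ->.
rewrite complE nim' negbK /= => im'.
have [p [q [pM qM ap aq [_ pq]]]] := split_nonadj Mconn m'M mM im' im.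
by exists p, q.
Qed.

Let fullM_AI x : x \in full (compl G) M -> x \in A \/ x \in I.
Proof.
move=> /fullP[xM hx]; have [m mM] := M0; apply: (nonfullM xM mM).
by have /andP[] := hx m mM.
Qed.

(** Passing to the complement exchanges the roles: [anti (compl G) M] is the set of vertices
    complete to [M] in [G]. *)
Let antiM x : x \in anti (compl G) M -> x \notin M /\ forall m, m \in M -> G x m.
Proof.
move=> /antiP[xM hx]; split=> // m mM; have := hx m mM.
by rewrite complE negb_and !negbK => /orP[/eqP xm|//]; rewrite xm mM in xM.
Qed.

Let antiM_in x : x \notin M -> (forall m, m \in M -> G x m) -> x \in anti (compl G) M.
Proof. by move=> xM hx; apply/antiP; split=> // m mM; rewrite complE hx // andbF. Qed.

Let core_in x y : x \in anti (compl G) M -> y \in anti (compl G) M -> x != y -> ~~ G x y ->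
  x \in core (compl G) M.
Proof. by move=> xR yR xy nxy; apply/coreP; split=> //; exists y; rewrite // complE xy. Qed.

Let C_anti c : c \in C -> c \in anti (compl G) M.
Proof.
move=> cC; apply: antiM_in; last by move=> m; apply: C_fullM.
by apply: contraTN cC; apply: MC.
Qed.

Let a0 : exists2 a, a \in A & a \in anti (compl G) M.
Proof.
have [m mM] := M0; have /mixedP[_ [a aA ma] _] := ML mM; exists a => //.
apply: antiM_in => [|m' m'M]; first by apply: contraTN aA; apply: MA.
by apply: (A_uniform aA mM); rewrite // sym.
Qed.

Let AC_neq a c : a \in A -> c \in C -> a != c.
Proof. by move=> aA cC; apply: contraTneq aA => ->; apply: CA. Qed.

Let C_core c : c \in C -> c \in core (compl G) M.
Proof.
move=> cC; have [a aA aR] := a0.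
by apply: (core_in (C_anti cC) aR); rewrite 1?(eq_sym c) 1?(sym c); [exact: AC_neq | exact: AC].
Qed.

Let core_anti x : x \in core (compl G) M -> x \in anti (compl G) M.
Proof. by case/coreP. Qed.

(** If [x] and [y] were non-adjacent, they would form a house with [i] and a non-adjacent pair [p],
    [q] of [M] split by [i]. *)
Let core_full i x y : i \in mixed (compl G) M -> x \in core (compl G) M ->
  y \in core (compl G) M -> G i x -> ~~ G i y -> G y x.
Proof.
move=> iL /core_anti/antiM[_ hx] /core_anti/antiM[_ hy] ix iy.
have [p [q [pM qM ip iq pq]]] := mixedM_nbrs iL.
apply: contraT => yx; exfalso.
by apply: (nH (a := p) (b := q) (c := i) (d := y) (f := x)); rewrite // sym ?hx ?hy.
Qed.

(** In the complement, the union of [A], [C], [M] and [i] is connected and anticomplete to the edge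
    [b b']. This separated pair has at least two vertices more than [A] and [C] together. *)
Let larger_pair i b b' : i \in I -> b \in full G A -> b' \in full G A ->
  b \in anti (compl G) M -> b' \in anti (compl G) M ->
  (forall c, c \in C -> G c b) -> (forall c, c \in C -> G c b') -> G i b -> G i b' ->
  b != b' -> ~~ G b b' -> False.
Proof.
move=> iI /fullP[bA hbA] /fullP[b'A hb'A] /antiM[bM hbM] /antiM[b'M hb'M] hbC hb'C ib ib' bb' nbb'.
have [iA iC hi] := IP _ iI; have [c0 c0C] := C0; have [a1 a1A] := A0.
(* Arranged for two uses of [connectedU]: in the complement [c0] is adjacent to all of [A], and each
   vertex of [C], each of [M] and [i] has a neighbour in [A]. *)
pose S := [set c0] :|: A :|: (C :|: M :|: [set i]).
have hS s d : s \in S -> d \in [set b; b'] -> G s d.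
  rewrite !inE => sS; case/orP: sS => [/orP[/eqP->|sA]|/orP[/orP[sC|sM]|/eqP->]] /orP[] /eqP->;
  by [auto | rewrite sym; auto].
have /maxAC' : separated (compl G) S [set b; b'].
  apply/separatedP; split.
  - apply: connectedU; first apply: connectedU (connected1 _ _) _.
      by move=> a aA; exists c0; rewrite ?set11 // complE eq_sym AC_neq //= sym AC.
    have hA d : (exists2 a, a \in A & (d \notin A) && ~~ G a d) ->
        exists2 s, s \in [set c0] :|: A & compl G s d.
      move=> [a aA /andP[dA ad]]; exists a; first by rewrite inE aA orbT.
      by rewrite complE ad andbT; apply: contraNneq dA => <-.
    move=> d; rewrite !in_setU => /orP[/orP[dC|dM]|/set1P->]; apply: hA.
    + by exists a1; rewrite // CA // AC.
    + have /mixedP[dA _ [a aA da]] := ML dM.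
      by exists a; rewrite // dA sym.
    + by exists a1; rewrite // iA sym hi.
  - by apply: leq_trans A2 _; apply/subset_leq_card/subsetP => x xA; rewrite !inE xA !orbT.
  - by exists b; rewrite !inE eqxx.
  - move=> c; rewrite !inE => /orP[]/eqP->; [exists b' | exists b]; rewrite ?inE ?eqxx ?orbT //.
      by rewrite complE bb'.
    by rewrite complE eq_sym bb' sym.
  - by move=> s d sS dB; rewrite complE hS // andbF.
rewrite cards2 bb' leqNgt => /negP; apply; rewrite addn2 ltnS.
suff : #|A| + #|C| <= #|S| by move/leqW.
have -> : #|A| + #|C| = #|A :|: C|.
  rewrite -cardsUI; have -> : A :&: C = set0; last by rewrite cards0 addn0.
  by apply/setP => x; rewrite !inE; apply/negP => /andP[xA /CA]; rewrite xA.
by apply/subset_leq_card/subsetP => x; rewrite !inE => /orP[]->; rewrite !orbT.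
Qed.

(** The anticomponent [M'] containing [b] and [b'] contradicts the choice of [M]: [i] is complete to
    [M'] by [core_full] but not to [M], and a vertex [j] of [I] complete to [M] but missing some [m]
    in [M'] would give the house on [p], [q], [i], [j], [m]. *)
Let larger_anticomponent i b b' : i \in mixed (compl G) M ->
  b \in mixed G A -> b' \in mixed G A -> b \in anti (compl G) M -> b' \in anti (compl G) M ->
  G i b -> b != b' -> ~~ G b b' -> False.
Proof.
move=> iL bL b'L bR b'R ib bb' nbb'.
have [bM _] := antiM bR; have iI := mixedM_I iL.
have [M' [M'comp bM' b'M']] := anticomponent_exists bL b'L bb' nbb'.
have [M'L M'conn _ _] := anticomponentP _ M'comp.
have disj x : x \in M' -> x \notin M.
  move=> xM'; apply/negP => xM.
  have /connectedP/(_ M x b xM' xM bM' bM)[p [q [pM' pM qM' qM]]] := M'conn.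
  by rewrite complE MLM ?andbF // M'L.
have M'R x : x \in M' -> x \in anti (compl G) M.
  move=> xM'; apply: antiM_in; first exact: disj.
  by move=> m mM; rewrite sym MLM //; [exact: M'L | exact: disj].
have iM' m : m \in M' -> G i m.
  move=> mM'; apply: contraT => im.
  have [p [q [pM qM ip iq [pq npq]]]] := split_nonadj M'conn bM' mM' ib im.
  have pC : p \in core (compl G) M by apply: (core_in (M'R _ pM) (M'R _ qM)).
  have qC : q \in core (compl G) M.
    by apply: (core_in (M'R _ qM) (M'R _ pM)); rewrite 1?eq_sym // sym.
  by have := core_full iL pC qC ip iq; rewrite sym (negPf npq).
have [p [q [pM qM ip iq pq]]] := mixedM_nbrs iL.
have := Mmax M'comp; rewrite leqNgt => /negP; apply.
apply/proper_card/properP; split.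
  apply/subsetP => j; rewrite !inE => /andP[jI /forall_inP jM]; rewrite jI /=.
  have jI' : j \in I by rewrite inE.
  apply/forall_inP => m mM'; apply: contraT => jm; exfalso.
  have [_ hm] := antiM (M'R m mM').
  apply: (nH (a := p) (b := q) (c := i) (d := j) (f := m)) => //; try edge.
  - exact: I_stable.
  - by rewrite sym jM.
  - by rewrite sym hm.
  - by rewrite sym jM.
  - by rewrite sym hm.
  - exact: iM'.
exists i; first by rewrite inE iI; apply/forall_inP.
by rewrite inE negb_and; apply/orP; right; apply/forall_inPn; exists q.
Qed.

(** A core vertex [b] adjacent to [i] has a non-neighbour [b'] in the core, also adjacent to [i] by
    [core_full]. Each of the two is complete to [A] or mixed on it. Two of the first kind enlarge
    the pair, two of the second give a better anticomponent, and one of each kind would be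
    adjacent. *)
Let mixedM_core i c : i \in mixed (compl G) M -> c \in core (compl G) M -> ~~ G i c.
Proof.
move=> iL bC; apply/negP => ib; set b := c in bC ib.
have iI := mixedM_I iL; have [iA iC hi] := IP _ iI.
have /coreP[bR [b' b'R /andP[bb' nbb']]] := bC.
have b'C : b' \in core (compl G) M by apply: (core_in b'R bR); rewrite 1?eq_sym // sym.
have ib' : G i b'.
  by apply: contraT => nib'; have := core_full iL bC b'C ib nib'; rewrite sym (negPf nbb').
have hC x d : x \in core (compl G) M -> G i x -> d \in C -> G d x.
  by move=> xC ix dC; apply: (core_full iL xC (C_core dC) ix); apply: IC.
have [a aA aR] := a0; have [d dC] := C0.
have place x : x \in core (compl G) M -> G i x -> x \in full G A \/ x \in mixed G A.
  move=> xC ix; have /orP[xA|/or4P[xC'|xB|xL|xI]] := outside x; [| |by left|by right|].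
  - by have := hi x xA; rewrite ix.
  - by have := IC iI xC'; rewrite ix.
  - by have := I_stable iI xI; rewrite ix.
have [bB|bL] := place b bC ib; have [b'B|b'L] := place b' b'C ib'.
- by apply: (larger_pair iI bB b'B bR b'R _ _ ib ib' bb' nbb') => e eC; apply: hC.
- by have := mixed_full b'L bB; rewrite sym (negPf nbb').
- by have := mixed_full bL b'B; rewrite (negPf nbb').
exact: (larger_anticomponent iL bL b'L bR b'R ib bb' nbb').
Qed.

Lemma anticomponent_divide : split_divide (compl G) M.
Proof.
split=> //.
- by have [c cC] := C0; exists c; apply: C_core.
- by move=> x y /mixedM_I xI /mixedM_I yI xy; rewrite complE xy I_stable.
- move=> x y xL yB; have /mixedM_I xI := xL; rewrite complE; apply/andP; split.
    apply: contraTneq yB => <-; apply/negP => /fullP[_ h].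
    by have /mixedP[_ _ [m mM]] := xL; rewrite h.
  by have [yA|yI] := fullM_AI yB; [have [_ _] := IP _ xI; apply | apply: I_stable].
- move=> x y xL yC; rewrite complE mixedM_core // andbT.
  apply: contraTneq (core_anti yC) => <-; apply/negP => /antiP[_ h].
  by have /mixedP[_ [m mM xm] _] := xL; have := h m mM; rewrite xm.
Qed.

End Anticomponent.

Lemma maximal_pair_divide : split_divide G A \/ exists M, split_divide (compl G) M.
Proof.
case: (boolP [exists M, anticomponent M]) => [/existsP[M0 M0c]|noM].
  have [M Mc Mmax] := @arg_maxnP _ M0 anticomponent
    (fun M => #|[set i in I | [forall m in M, G i m]]|) M0c.
  by right; exists M; apply: anticomponent_divide.
left; apply: mixed_clique_divide => x y xL yL xy; apply: contraNT noM => nxy.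
by have [M [Mc _ _]] := anticomponent_exists xL yL xy nxy; apply/existsP; exists M.
Qed.

End MaximalPair.

(** * Decompositions from homogeneous sets and split divides *)

Section Pullback.
Variables (V W : finType) (G : sgraph V) (g : W -> V).

Definition pull_rel : rel W := fun x y => G (g x) (g y).
Lemma pull_sym : symmetric pull_rel. Proof. by move=> x y; apply: adj_sym. Qed.
Lemma pull_irr : irreflexive pull_rel. Proof. by move=> x; apply: adj_irr. Qed.
Definition pull : sgraph W := SGraph pull_sym pull_irr.

(** A copy in the pullback composes with [g] to a copy in [G], since [induces] speaks of adjacencies
    only. *)
Lemma pull_free : P5_coP5_free G -> P5_coP5_free pull.
Proof.
move=> /P5_coP5_freeP[p c]; apply/P5_coP5_freeP.
by split=> i; [apply: p | apply: c]; apply: (@induces_map _ _ _ _ _ g _ i).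
Qed.

End Pullback.

Lemma card_sig_set (V : finType) (X : {set V}) : #|{: {x : V | x \in X}}| = #|X|.
Proof. by rewrite card_sig; apply: eq_card. Qed.

(** [G] arises by substituting the graph on [H] for a representative [h] in the graph on [h] and the
    complement of [H]. *)
Lemma homogeneous_substitution (V : finType) (G : sgraph V) (H : {set V}) :
  P5_coP5_free G -> homogeneous G H -> 1 < #|H| -> #|H| < #|V| ->
  from_substitution (@smaller_free V) G.
Proof.
move=> frG hom H1 HV; have /card_gt0P[h hH] : 0 < #|H| by apply: ltnW.
pose X := h |: ~: H; have hX : h \in X by rewrite !inE eqxx.
pose V1 : finType := {x : V | x \in H}; pose V2 : finType := {x : V | x \in X}.
pose u : V2 := exist _ h hX.
pose g (w : V1 + {v : V2 | v != u}) : V :=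
  match w with inl x => val x | inr y => val (val y) end.
have gH (y : {v : V2 | v != u}) : val (val y) \notin H.
  case: y => -[y /= yX] yu /=; move: (yX); rewrite !inE => /orP[/eqP yh|//].
  by case/eqP: yu; apply: val_inj.
exists V1, V2, (pull G val), (pull G val), u, (pull G g); split.
- split=> // y; split=> [yu x | nyu x] /=; rewrite /pull_rel /=.
    by rewrite (hom _ h _ (valP x) hH (gH y)).
  by rewrite (hom _ h _ (valP x) hH (gH y)).
- apply: (@iso_from _ _ _ _ g) => // [[x|x] [y|y] /= xy | x].
  + by congr inl; apply: val_inj.
  + by case/negP: (gH y); rewrite -[val (val y)]xy (valP x).
  + by case/negP: (gH x); rewrite [val (val x)]xy (valP y).
  + by congr inr; do 2!apply: val_inj.
  case: (boolP (x \in H)) => xH; first by exists (inl (exist _ x xH)).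
  have xX : x \in X by rewrite !inE xH orbT.
  have xu : (exist _ x xX : V2) != u.
    by apply: contraNneq xH => /(congr1 val) /= ->.
  by exists (inr (exist _ (exist _ x xX : V2) xu)).
- by split; [rewrite card_sig_set | apply: pull_free].
split; last exact: pull_free.
rewrite card_sig_set cardsU1 inE hH /= add1n.
by rewrite -(cardsC H) -add2n leq_add2r.
Qed.

Lemma C5_spanning_pentagon (V : finType) (G : sgraph V) a b c d f : C5 G a b c d f ->
  (forall x, x \in [:: a; b; c; d; f]) -> is_pentagon G.
Proof.
move=> [[ab bc cd df fa] [ac bd cf da fb]] all; pose s := [:: a; b; c; d; f].
have E (i j : 'I_5) : G (nth a s i) (nth a s j) = cycle_graph 5 i j.
  case: i j => [[|[|[|[|[|i]]]]] hi] [[|[|[|[|[|j]]]]] hj] //;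
  rewrite /= ?adj_irr /cycle_rel -val_eqE /=; first [done | exact/negbTE | by rewrite adj_sym | by rewrite adj_sym; apply/negbTE].
apply: (@iso_from _ _ _ _ (fun i : 'I_5 => nth a s i)) => // [i j /= ij | x].
  (* Equal images would make two distinct indices twins in the pentagon, which has no twins. *)
  apply: contraTeq isT => nij; have := (fun l => E i l, fun l => E j l).
  rewrite ij => -[Ei Ej]; have {Ei Ej} : forall l, cycle_graph 5 i l = cycle_graph 5 j l.
    by move=> l; rewrite -Ei -Ej.
  move: nij; clear; case: i j => [[|[|[|[|[|i]]]]] hi] [[|[|[|[|[|j]]]]] hj] //= _ h;
  have := (h (@Ordinal 5 0 isT), h (@Ordinal 5 1 isT), h (@Ordinal 5 2 isT), h (@Ordinal 5 3 isT), h (@Ordinal 5 4 isT));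
  rewrite /cycle_rel -?val_eqE /=; by case; do ?[case].
have := all x; rewrite -/s -index_mem => xs.
by exists (Ordinal xs); rewrite /= nth_index.
Qed.

Section Unification.
Variables (V : finType) (G : sgraph V) (S : {set V}).
Hypotheses (frG : P5_coP5_free G) (divS : split_divide G S).

Let A : finType := {x | x \in S}.
Let B : finType := {x | x \in full G S}.
Let C : finType := {x | x \in core G S}.
Let L : finType := {x | x \in mixed G S}.
Let T : finType := {x | x \in anti G S :\: core G S}.

Let gU (w : vertU A B C L T) : V := match w with
  | inl x => val x | inr (inl (inl x)) => val x | inr (inl (inr x)) => val x
  | inr (inr (inl x)) => val x | inr (inr (inr x)) => val x end.

Let S0 : exists a, a \in S.
Proof. by case: divS => S1 _ _ _ _; apply/card_gt0P; apply: ltnW. Qed.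

(** One numerical equation states that the five sets partition the vertices; injectivity and
    surjectivity of [gU] are both read off from it. *)
Let parts x : (x \in S) + (x \in full G S) + (x \in core G S) + (x \in mixed G S)
  + (x \in anti G S :\: core G S) = 1.
Proof.
have [a aS] := S0.
have fS : x \in full G S -> x \notin S by case/fullP.
have mS : x \in mixed G S -> x \notin S by case/mixedP.
have aS' : x \in anti G S -> x \notin S by case/antiP.
have ca : x \in core G S -> x \in anti G S by case/coreP.
have fm : x \in full G S -> x \notin mixed G S.
  by move=> /fullP[_ h]; apply/negP => /mixedP[_ _ [b bS]]; rewrite h.
have fa : x \in full G S -> x \notin anti G S.
  by move=> /fullP[_ h]; apply/negP => /antiP[_ /(_ a aS)]; rewrite h.
have ma : x \in mixed G S -> x \notin anti G S.
  by move=> /mixedP[_ [b bS xb] _]; apply/negP => /antiP[_ /(_ b bS)]; rewrite xb.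
rewrite in_setD; have := trichotomy G S x; move: fS mS aS' ca fm fa ma.
case: (x \in S); case: (x \in full G S); case: (x \in core G S);
  by case: (x \in mixed G S); case: (x \in anti G S) => //=; do ?[move/(_ isT) => // | move=> _] => //.
Qed.

Let gU_inj : injective gU.
Proof.
move=> w w'.
case: w w' => [x|[[x|x]|[x|x]]] [y|[[y|y]|[y|y]]] xy;
  try by do ?[congr inl | congr inr]; apply: val_inj.
all: have := parts (val x); have := valP y; move: xy => /= <-; rewrite (valP x) => ->.
all: by do !case: (_ \in _).
Qed.

Let gU_surj x : exists w, gU w = x.
Proof.
have := parts x.
case xS: (x \in S); first by exists (inl (exist _ x xS)).
case xB: (x \in full G S); first by exists (inr (inl (inl (exist _ x xB)))).
case xC: (x \in core G S); first by exists (inr (inl (inr (exist _ x xC)))).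
case xL: (x \in mixed G S); first by exists (inr (inr (inl (exist _ x xL)))).
case xT: (x \in anti G S :\: core G S) => // _.
by exists (inr (inr (inr (exist _ x xT)))).
Qed.

Let core2 : exists x y, [/\ x \in core G S, y \in core G S & x != y].
Proof.
case: divS => _ [x xC] _ _ _; have /coreP[xa [y ya xy]] := xC; exists x, y; split=> //.
  by apply/coreP; split=> //; exists x; rewrite // adj_sym.
by apply: contraTneq xy => ->; rewrite adj_irr.
Qed.

(** Any vertex of the core can play the role of [c], so that [G1] comes from an induced subgraph of
    [G]. *)
Let g1 (c : C) (w : vert1 A L T) : V := match w with
  | None => val c | Some (inl x) => val x
  | Some (inr (inl x)) => val x | Some (inr (inr x)) => val x end.

(** The vertex [a] of [G2] is sent to a chosen vertex of [S]; adjacencies are preserved except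
    towards the neighbours of that vertex in [L]. *)
Let f2 (a : A) (w : vert2 B C L T) : V := match w with
  | None => val a | Some (inl (inl x)) => val x | Some (inl (inr x)) => val x
  | Some (inr (inl x)) => val x | Some (inr (inr x)) => val x end.

(** Defined by hand and not as a pullback: [a] must be anticomplete to [L], and [S] may contain no
    such vertex. *)
Let rel2 (w w' : vert2 B C L T) : bool := match w, w' with
  | Some x, Some y => G (gU (inr x)) (gU (inr y))
  | None, Some (inl (inl _)) | Some (inl (inl _)), None => true
  | _, _ => false end.

Let rel2_sym : symmetric rel2.
Proof. by case=> [[[x|x]|x]|] [[[y|y]|y]|] //=; apply: adj_sym. Qed.

Let rel2_irr : irreflexive rel2.
Proof. by case=> [[[x|x]|x]|] //=; apply: adj_irr. Qed.

Let G2 := SGraph rel2_sym rel2_irr.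

Let STanti x t : x \in S -> t \in anti G S -> G x t = false.
Proof. by move=> xS /antiP[_ h]; rewrite adj_sym; apply/negbTE/h. Qed.

Let SB x b : x \in S -> b \in full G S -> G x b.
Proof. by move=> xS /fullP[_ h]; rewrite adj_sym; apply/h. Qed.

Let coreA x : x \in core G S -> x \in anti G S. Proof. by case/coreP. Qed.

Let Tanti x : x \in anti G S :\: core G S -> x \in anti G S. Proof. by case/setDP. Qed.

Let Tisolated x y : x \in anti G S :\: core G S -> y \in anti G S -> G x y = false.
Proof.
move=> /setDP[xa xC] ya; apply/negP => xy; case/negP: xC.
by apply/coreP; split=> //; exists y.
Qed.

Definition replacement_case k := all5 (fun i => k i != cA) || at_most_one (fun i => k i == cL).

Definition replacement_ok (h : rel nat) :=
  exhaust cA colours (fun k => consistent (Some false) h k ==> replacement_case k).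

(* The vertex a of G2 need not have a counterpart in G, but a copy of P5 or of
   its complement that uses it meets L in at most one vertex l, and then a
   non-neighbour of l in A may play the role of a. *)
Let G2_induces h : twinfree h -> replacement_ok h -> induces h G2 -> induces h G.
Proof.
move=> tw /exhaustP ok [v vE]; have [_ _ Lcl LB LC] := divS.
pose col (x : vert2 B C L T) := match x with
  | None => cA | Some (inl (inl _)) => cB | Some (inl (inr _)) => cC
  | Some (inr (inl _)) => cL | Some (inr (inr _)) => cT end.
pose k i := col (v i).
have con : consistent (Some false) h k.
  apply/all5P => i i5; apply/all5P => j j5; case: eqVneq => //= ij.
  rewrite -vE //; have : v i != v j by rewrite (induces_inj tw vE).
  rewrite /k; case: (v i) (v j) => [[[x|x]|[x|x]]|] [[[y|y]|[y|y]]|] //= xy; apply/eqP.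
  - by rewrite adj_sym LB ?(valP x) ?(valP y).
  - by rewrite adj_sym LC ?(valP x) ?(valP y).
  - by rewrite adj_sym Tisolated ?(valP y) ?coreA ?(valP x).
  - by rewrite LB ?(valP x) ?(valP y).
  - by rewrite LC ?(valP x) ?(valP y).
  - by rewrite Lcl ?(valP x) ?(valP y).
  - by rewrite Tisolated ?(valP x) ?coreA ?(valP y).
  by rewrite Tisolated ?(valP x) ?Tanti ?(valP y).
have kin i : i < 5 -> k i \in colours by rewrite mem_colours.
have main (a : A) :
    (forall i j l, i < 5 -> j < 5 -> v i = None -> v j = Some (inr (inl l)) -> ~~ G (val a) (val l)) ->
    induces h G.
  move=> ha; exists (f2 a \o v) => i j i5 j5; rewrite -vE //=.
  case Ei: (v i) => [[[x|x]|[x|x]]|]; case Ej: (v j) => [[[y|y]|[y|y]]|] //=.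
  - by rewrite adj_sym SB ?(valP x) ?(valP a).
  - by rewrite adj_sym STanti ?coreA ?(valP x) ?(valP a).
  - by rewrite adj_sym; apply/negbTE/(ha j i).
  - by rewrite adj_sym STanti ?Tanti ?(valP x) ?(valP a).
  - by rewrite SB ?(valP y) ?(valP a).
  - by rewrite STanti ?coreA ?(valP y) ?(valP a).
  - by apply/negbTE/(ha i j).
  - by rewrite STanti ?Tanti ?(valP y) ?(valP a).
  by rewrite adj_irr.
have [a aS] := S0.
have /implyP/(_ con)/orP[/all5P noA|L1] :
  consistent (Some false) h k ==> replacement_case k := ok k kin.
  apply: (main (exist _ a aS)) => i j l i5 _ vi _.
  by have := noA i i5; rewrite /k vi.
case: (boolP (all5 (fun i => k i != cL))) => [/all5P noL | /allPn[i]].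
  apply: (main (exist _ a aS)) => _ j l _ j5 _ vj.
  by have := noL j j5; rewrite /k vj.
rewrite mem_iota negbK => i5 ki; move: (ki); rewrite /k.
case vi: (v i) => [[[x|x]|[l|x]]|] //= _.
have /mixedP[_ _ [b bS lb]] := valP l.
apply: (main (exist _ b bS)) => _ j l' _ j5 _ vj /=.
have ij : i = j by apply: (at_most_oneP L1 i5 j5 ki); rewrite /k vj.
by move: vj; rewrite -ij vi => -[<-]; rewrite adj_sym.
Qed.

Lemma divide_unification : from_split_unification (@smaller_free V) G.
Proof.
have [c [c' [cC c'C cc']]] := core2; have [S2 _ Lcl LB LC] := divS.
have [a aS] := S0; have [_ cS] := antiP _ _ _ (coreA cC).
have cardV : #|V| = #|{: vertU A B C L T}|.
  have [g gK Kg] : bijective gU.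
    have surj x : exists w, gU w == x by have [w <-] := gU_surj x; exists w.
    exists (fun x => xchoose (surj x)) => [w|x]; last exact/eqP/(xchooseP (surj x)).
    by apply: gU_inj; apply/eqP/(xchooseP (surj _)).
  by rewrite (bij_eq_card (Bijective Kg gK)).
(* With two vertices in each of [C] and [A], trading [B] and [C] for [c], or [A] for [a], makes the
   graph smaller. *)
have cardC : 1 < #|C|.
  by rewrite card_sig_set; apply/card_gt1P; exists c, c'.
have cardA : 1 < #|A| by rewrite card_sig_set.
pose c1' : C := exist _ c cC.
exists A, B, C, L, T, (pull G (g1 c1')), G2, (pull G gU); split.
- split; rewrite ?(ltnW cardA) ?(ltnW cardC) //.
  + split.
    * by move=> x y xy; apply: Lcl; rewrite ?(valP x) ?(valP y).
    * by move=> x y; apply/negbT; apply: Tisolated; [exact: valP x | apply/Tanti/(valP y)].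
    * by move=> x y; apply/negbT/STanti; [exact: valP x | apply/Tanti/(valP y)].
    * by move=> u x /=; rewrite /pull_rel adj_sym LC // (valP x).
    * split=> u x /=; first by apply: cS; exact: (valP x).
      by rewrite /pull_rel adj_sym /= (Tisolated (valP x)) ?coreA.
  + split=> //.
    * by move=> x y; apply/negbT; apply: Tisolated; [exact: valP x | apply/coreA/(valP y)].
    * by split=> x y; [apply: LB | apply: LC]; rewrite ?(valP x) ?(valP y).
- split.
  + by move=> [x|[x|x]] [y|[y|y]].
  + by move=> [[x|x]|[x|x]] [[y|y]|[y|y]].
  + by move=> x y; apply: SB; [exact: valP x | exact: valP y].
  + by move=> x y; apply/negbT/STanti; [exact: valP x | apply/coreA/(valP y)].
- by apply: (iso_from gU_inj gU_surj).
- split; last exact: pull_free.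
  rewrite cardV /vert1 /vertU card_option !card_sum.
  by move: cardC; clear; lia.
split.
  rewrite cardV /vert2 /vertU card_option !card_sum.
  by move: cardA; clear; lia.
have [nP nc] := (P5_coP5_freeP G).1 frG.
by apply/P5_coP5_freeP; split=> /G2_induces i; [apply: nP | apply: nc]; apply: i; vm_compute.
Qed.

End Unification.

(** * Passing to the complement and assembling the characterization *)

Lemma exists_C5 (V : finType) (G : sgraph V) :
  (exists a b c d f, C5 G a b c d f) \/ (forall a b c d f, ~ C5 G a b c d f).
Proof.
pose p t := let: (a, b, c, d, f) := t in
  [&& G a b, G b c, G c d, G d f & G f a] &&
  [&& ~~ G a c, ~~ G b d, ~~ G c f, ~~ G d a & ~~ G f b].
case: (boolP [exists t, p t]) => [/existsP[[[[[a b] c] d] f]] | /existsPn no].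
  by case/andP=> /and5P? /and5P?; left; exists a, b, c, d, f.
right=> a b c d f [/and5P h /and5P h'].
by have := no (a, b, c, d, f); rewrite /= h h'.
Qed.

Lemma C5_compl (V : finType) (G : sgraph V) a b c d f :
  C5 (compl G) a b c d f -> C5 G a c f b d.
Proof.
(* Non-adjacency in the complement means adjacency or equality in [G]; the vertex [w], adjacent
   there to [z] but not to [x], excludes equality. *)
have adjI x z w : compl G z w -> ~~ compl G w x -> ~~ compl G x z -> G x z.
  move=> zw wx; rewrite [in X in X -> _]complE negb_and !negbK => /orP[/eqP xz|//].
  by rewrite xz adj_sym zw in wx.
move=> [[ab bc cd df fa] [ac bd cf da fb]].
have nadj x y : compl G x y -> ~~ G x y by case/andP.
split; split; try (by apply: nadj); try by rewrite adj_sym; apply: nadj.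
- exact: adjI cd da ac.
- exact: adjI fa ac cf.
- exact: adjI bc cf fb.
- exact: adjI df fb bd.
exact: adjI ab bd da.
Qed.

Lemma exists_2K2 (V : finType) (G : sgraph V) :
  (exists a b c d, [/\ G a b, G c d & [/\ ~~ G a c, ~~ G a d, ~~ G b c & ~~ G b d]]) \/ no_2K2 G.
Proof.
pose p t := let: (a, b, c, d) := t in
  [&& G a b, G c d, ~~ G a c, ~~ G a d, ~~ G b c & ~~ G b d].
case: (boolP [exists t, p t]) => [/existsP[[[[a b] c] d]] | /existsPn no].
  by case/and5P=> ? ? ? ? /andP[? ?]; left; exists a, b, c, d.
right=> a b c d h1 h2 h3 h4 h5 h6.
by have := no (a, b, c, d); rewrite /= h1 h2 h3 h4 h5 h6.
Qed.

Lemma separated_2K2 (V : finType) (G : sgraph V) a b c d :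
  G a b -> G c d -> ~~ G a c -> ~~ G a d -> ~~ G b c -> ~~ G b d ->
  separated G ([set a] :|: [set b]) [set c; d].
Proof.
move=> ab cd ac ad bc bd; apply/separatedP; split.
- apply: connectedU; first exact: connected1.
  by move=> x /set1P->; exists a; rewrite ?set11.
- apply/card_gt1P; exists a, b; rewrite !inE !eqxx ?orbT; split=> //.
  by apply: contraTneq ab => ->; rewrite adj_irr.
- by exists c; rewrite !inE eqxx.
- move=> x; rewrite !inE => /orP[]/eqP->; [exists d | exists c]; rewrite ?inE ?eqxx ?orbT //.
  by rewrite adj_sym.
by move=> x y; rewrite !inE => /orP[]/eqP-> /orP[]/eqP->.
Qed.

Lemma separated_compl2 (V : finType) (G : sgraph V) A C :
  separated (compl (compl G)) A C -> separated G A C.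
Proof.
move=> /separatedP[/connectedP cA A2 C0 nbr AC]; apply/separatedP; split=> //.
- apply/connectedP => T x y xA xT yA yT.
  have [x' [y' [? ? ? ? xy]]] := cA T x y xA xT yA yT.
  by exists x', y'; split; rewrite // -[G _ _]complK.
- by move=> c /nbr[c' c'C cc']; exists c'; rewrite // -[G _ _]complK.
by move=> a c aA cC; rewrite -[G _ _]complK AC.
Qed.

Lemma separated_unification (V : finType) (G : sgraph V) A C : P5_coP5_free G ->
  (forall a b c d f, ~ C5 G a b c d f) -> separated G A C ->
  (forall A' C', separated G A' C' -> #|A'| + #|C'| <= #|A| + #|C|) ->
  (forall A' C', separated (compl G) A' C' -> #|A'| + #|C'| <= #|A| + #|C|) ->
  from_split_unification (@smaller_free V) G \/
  from_split_unification (@smaller_free V) (compl G).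
Proof.
move=> frG nC5 sep m1 m2.
have [d|[M d]] := maximal_pair_divide (free_no_P5 frG) (free_no_house frG) nC5 sep m1 m2.
  by left; apply: (divide_unification frG d).
by right; apply: (divide_unification (P5_coP5_free_compl frG) d).
Qed.

Lemma from_split_unification_compl2 (V : finType) (G : sgraph V) Q :
  from_split_unification Q (compl (compl G)) -> from_split_unification Q G.
Proof.
move=> [A [B [C [L [T [G1 [G2 [G' [cmp uni [f [f_bij fE]] Q1 Q2]]]]]]]]].
exists A, B, C, L, T, G1, G2, G'; split=> //; exists f; split=> // x y.
by rewrite -fE complK.
Qed.

(** If neither [G] nor its complement has a separated pair, neither contains a 2K2, and [G] is
    split. Otherwise the total size is maximized over the pairs of both graphs at once, the boolean
    recording the graph, because the argument compares pairs of one graph with pairs of its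
    complement. *)
Lemma C5_free_split_or_unification (V : finType) (G : sgraph V) : P5_coP5_free G ->
  (forall a b c d f, ~ C5 G a b c d f) -> is_split G \/
  (from_split_unification (@smaller_free V) G \/
   from_split_unification (@smaller_free V) (compl G)).
Proof.
move=> frG nC5; pose side (s : bool) := if s then compl G else G.
pose P (t : bool * {set V} * {set V}) := separated (side t.1.1) t.1.2 t.2.
case: (boolP [exists t, P t]) => [/existsP[t0 Pt0] | /existsPn none]; last first.
  left; apply: Foldes_Hammer => //.
    have [[a [b [c [d [ab cd [ac ad bc bd]]]]]]|//] := exists_2K2 G.
    by have := none (false, [set a] :|: [set b], [set c; d]); rewrite /P separated_2K2.
  have [[a [b [c [d [ab cd [ac ad bc bd]]]]]]|//] := exists_2K2 (compl G).
  by have := none (true, [set a] :|: [set b], [set c; d]); rewrite /P separated_2K2.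
right; have [[[s A] C] /= Pt max] := @arg_maxnP _ t0 P (fun t => #|t.1.2| + #|t.2|) Pt0.
case: s Pt max => /= sep max.
  have [] : from_split_unification (@smaller_free V) (compl G) \/
      from_split_unification (@smaller_free V) (compl (compl G)).
    apply: (separated_unification (P5_coP5_free_compl frG) _ sep).
    - by move=> a b c d f /C5_compl/nC5.
    - by move=> A' C' sep'; apply: (max (true, A', C')).
    - by move=> A' C' /separated_compl2 sep'; apply: (max (false, A', C')).
    by right.
  by move=> /from_split_unification_compl2; left.
apply: (separated_unification frG nC5 sep).
- by move=> A' C' sep'; apply: (max (false, A', C')).
by move=> A' C' sep'; apply: (max (true, A', C')).
Qed.

Theorem mainTheorem1 (V : finType) (G : sgraph V) :
  P5_coP5_free G <->
  [\/ is_split G,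
      is_pentagon G,
      from_substitution (@smaller_free V) G
    | from_split_unification (@smaller_free V) G \/
      from_split_unification (@smaller_free V) (compl G)].
Proof.
have unif (W : finType) (H : sgraph W) : from_split_unification (@smaller_free W) H ->
    P5_coP5_free H.
  move=> [A [B [C [L [T [G1 [G2 [G' [cmp uni isoG [_ f1] [_ f2]]]]]]]]]].
  exact: (P5_coP5_free_iso isoG (unification_free cmp uni f1 f2)).
split=> [frG | [sG | pG | subG | [uG | uG]]].
- have [[a [b [c [d [f q]]]]] | nC5] := exists_C5 G.
    have nP := free_no_P5 frG; have nH := free_no_house frG.
    have [[H [hom H1 HV]] | all] := C5_homogeneous nP nH q.
      by constructor 3; apply: (homogeneous_substitution frG hom).
    by constructor 2; apply: (C5_spanning_pentagon q).
  have [sG | uG] := C5_free_split_or_unification frG nC5; first by constructor 1.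
  by constructor 4.
- exact: split_free.
- exact: P5_coP5_free_iso pG pentagon_free.
- have [V1 [V2 [G1 [G2 [u [G' [sub isoG [_ f1] [_ f2]]]]]]]] := subG.
  exact: (P5_coP5_free_iso isoG (substitution_free sub f1 f2)).
- exact: unif.
- exact/P5_coP5_free_compl_inv/unif.
Qed.
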